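(* Let $(M,\phi)$ be a regular connection over $K_\infty[[t]]$ of rank $r$ with exponents $\lambda_1,\dots,\lambda_r$. (1) There exists a (possibly non-unique) $\phi$-stable $\mathbf L^{+,\dagger}_{K,\infty}$-lattice $M^\dagger\subset M$. (2) If $\mathrm{type}(-\lambda_i)>0$ for all $i$, then for any $\phi$-stable $\mathbf L^{+,\dagger}_{K,\infty}$-lattice $M^\dagger$ of $M$, the natural map $\mathrm{R}\Gamma(\phi,M^\dagger)\to\mathrm{R}\Gamma(\phi,M)$ is a quasi-isomorphism. (3) If $\mathrm{type}(\lambda_i-\lambda_j)>0$ for all pairs $i,j$, then the $\phi$-stable $\mathbf L^{+,\dagger}_{K,\infty}$-lattice of $M$ is unique (as a subset of $M$).
   Context: Let $K$ be a complete discretely valued field of characteristic $0$ with perfect residue field of characteristic $p$, $\overline K$ an algebraic closure with $p$-adic valuation $v_p$, $K_m=K(\mu_{p^m})$, $K_\infty=\bigcup_m K_m$, $t$ a variable. Let $\mathbf L^{+,\dagger}_{K,\infty}=\bigcup_m\mathbf O^\dagger(K_m,t)\subset K_\infty[[t]]$, where $\mathbf O^\dagger(K_m,t)\subset K_m[[t]]$ is the ring of power series with positive radius of convergence. For $A\in\{\mathbf L^{+,\dagger}_{K,\infty},K_\infty[[t]]\}$, a regular connection over $A$ is a finite free $A$-module $M$ with a $K_\infty$-linear $\phi:M\to M$ satisfying $\phi(fx)=t\frac{df}{dt}x+f\phi(x)$; its exponents are the eigenvalues in $\overline K$ of the induced map on $M/tM$. $\mathrm{R}\Gamma(\phi,M)=[M\xrightarrow{\phi}M]$.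 A $\phi$-stable $\mathbf L^{+,\dagger}_{K,\infty}$-lattice of $M$ is a $\phi$-stable finite free $\mathbf L^{+,\dagger}_{K,\infty}$-submodule $M^\dagger\subset M$ such that $M^\dagger\otimes K_\infty[[t]]\to M$ is an isomorphism. For $\lambda\in\overline K$, $\mathrm{type}(\lambda)\in[0,1]$ is the radius of convergence (for $|\cdot|=p^{-v_p}$) of $\sum_{m\ge0,m\ne\lambda}z^m/(\lambda-m)$. *)

(* Defs.v *)
From HB Require Import structures.
From mathcomp Require Import all_boot all_order all_algebra.
From mathcomp Require Import all_classical all_reals all_analysis.

Set Implicit Arguments.
Unset Strict Implicit.
Unset Printing Implicit Defensive.

Import Order.TTheory GRing.Theory Num.Theory.
Import numFieldNormedType.Exports.

Local Open Scope classical_set_scope.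
Local Open Scope ring_scope.

Section Valuations.
Variables (R : realType) (F : fieldType).
Implicit Types (v : F -> \bar R).

Definition is_valuation v : Prop :=
  [/\ forall x, v x = +oo%E <-> x = 0,
      forall x, v x <> -oo%E,
      forall x y, v (x * y) = (v x + v y)%E
    & forall x y, (Order.min (v x) (v y) <= v (x + y)%R)%E].

(* The value group of a discrete valuation is normalised to be the integers. *)
Definition is_discrete v : Prop :=
  (exists u, v u = 1%E) /\
  (forall x, x != 0 -> exists n : int, v x = (n%:~R)%:E).

Definition is_complete v : Prop :=
  forall u : nat -> F,
    (forall B : R, exists N, forall m n, (N <= m)%N -> (N <= n)%N ->
       (B%:E <= v (u m - u n)%R)%E) ->
    exists l, forall B : R, exists N, forall n, (N <= n)%N ->
       (B%:E <= v (u n - l)%R)%E.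

(* The prime p vanishes in the residue field { v >= 0 } / { v > 0 }. *)
Definition residue_char v (p : nat) : Prop := prime p /\ (0 < v p%:R)%E.

(* The Frobenius of the residue field, of characteristic p, is onto. *)
Definition residue_perfect v (p : nat) : Prop :=
  forall x, (0 <= v x)%E ->
    exists y, (0 <= v y)%E /\ (0 < v (x - y ^+ p)%R)%E.

Definition vabs (p : nat) v (x : F) : R :=
  if x == 0 then 0 else (p%:R : R) `^ (- fine (v x)).

(* Radius of convergence of sum_n (a n) z^n: over a non-archimedean field the
   series converges exactly when its terms tend to 0. *)
Definition radius (p : nat) v (a : nat -> F) : \bar R :=
  ereal_sup [set r%:E | r in
    [set r : R | 0 <= r /\ (fun n => vabs p v (a n) * r ^+ n) @ \oo --> (0 : R)]].

Definition padic_type (p : nat) v (lambda : F) : \bar R :=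
  radius p v (fun m => if lambda == m%:R then 0 else (lambda - m%:R)^-1).

End Valuations.

Definition is_subfield (F : fieldType) (S : set F) : Prop :=
  [/\ S 1, forall x y, S x -> S y -> S (x - y)
         & forall x y, S x -> S y -> S (x / y)].

Section Cyclotomic.
Variables (p : nat) (K : fieldType) (Kbar : closedFieldType).
Variable iota : {rmorphism K -> Kbar}.

(* K_m = K(mu_{p^m}) inside Kbar *)
Definition Kcyc (m : nat) : set Kbar :=
  \bigcap_(S in [set S | [/\ is_subfield S, range iota `<=` S
                           & [set z | z ^+ (p ^ m) = 1] `<=` S]]) S.

Lemma Kcyc_subfield m : is_subfield (Kcyc m).
Proof.
split=> [S [[]]//|x y xK yK S SK|x y xK yK S SK]; case: (SK) => -[_ SB SV] _ _.
- by apply: SB; [exact: xK | exact: yK].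
- by apply: SV; [exact: xK | exact: yK].
Qed.

Lemma Kcyc_le m n : (m <= n)%N -> Kcyc m `<=` Kcyc n.
Proof.
move=> mn x xK S [Sf SK Smu]; apply: xK; split=> // z /= z1; apply: Smu => /=.
by rewrite -(subnKC mn) expnD exprM z1 expr1n.
Qed.

Definition Kinf_pred : {pred Kbar} := fun x => `[< exists m, Kcyc m x >].

Lemma Kinf_divring_closed : divring_closed Kinf_pred.
Proof.
have H (x y : Kbar) : x \in Kinf_pred -> y \in Kinf_pred ->
    exists m, Kcyc m x /\ Kcyc m y.
  move=> /asboolP[m xm] /asboolP[n yn]; exists (maxn m n).
  by split; [apply: Kcyc_le xm; rewrite leq_maxl|apply: Kcyc_le yn; rewrite leq_maxr].
split.
- by apply/asboolP; exists 0%N; have [] := Kcyc_subfield 0.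
- move=> x y xK yK; have [m [xm ym]] := H _ _ xK yK; apply/asboolP; exists m.
  by have [_ SB _] := Kcyc_subfield m; apply: SB.
- move=> x y xK yK; have [m [xm ym]] := H _ _ xK yK; apply/asboolP; exists m.
  by have [_ _ SV] := Kcyc_subfield m; apply: SV.
Qed.

HB.instance Definition _ :=
  GRing.isDivringClosed.Build Kbar Kinf_pred Kinf_divring_closed.

(* K_infty, the union of the K_m *)
Record Kinf := KInf { Kinf_val : Kbar; _ : Kinf_val \in Kinf_pred }.

HB.instance Definition _ := [isSub for Kinf_val].
HB.instance Definition _ := [Choice of Kinf by <:].
HB.instance Definition _ := [SubChoice_isSubIntegralDomain of Kinf by <:].
HB.instance Definition _ := [SubIntegralDomain_isSubField of Kinf by <:].

End Cyclotomic.

Arguments Kinf : clear implicits.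
Arguments Kinf p {K Kbar} iota.

Record powser (F : Type) := Powser { coefs : nat -> F }.
Coercion coefs : powser >-> Funclass.

HB.instance Definition _ (F : Type) := gen_eqMixin (powser F).
HB.instance Definition _ (F : Type) := gen_choiceMixin (powser F).

Section PowerSeries.
Variable F : fieldType.
Implicit Types f g h : powser F.

Lemma powserP f g : (forall n, f n = g n) <-> f = g.
Proof.
split=> [|->//]; case: f g => [f] [g] /= fg; congr Powser; exact/funext.
Qed.

Definition ps0 : powser F := Powser (fun=> 0).
Definition ps_opp f := Powser (fun n => - f n).
Definition ps_add f g := Powser (fun n => f n + g n).
Definition ps_const (c : F) := Powser (fun n => c *+ (n == 0%N)).
Definition ps_mul f g := Powser (fun n => \sum_(i < n.+1) f i * g (n - i)%N).

Let ps_addA : associative ps_add.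
Proof. by move=> f g h; apply/powserP => n /=; rewrite addrA. Qed.
Let ps_addC : commutative ps_add.
Proof. by move=> f g; apply/powserP => n /=; rewrite addrC. Qed.
Let ps_add0 : left_id ps0 ps_add.
Proof. by move=> f; apply/powserP => n /=; rewrite add0r. Qed.
Let ps_addN : left_inverse ps0 ps_opp ps_add.
Proof. by move=> f; apply/powserP => n /=; rewrite addNr. Qed.

HB.instance Definition _ :=
  GRing.isZmodule.Build (powser F) ps_addA ps_addC ps_add0 ps_addN.

Let trunc N f : {poly F} := \poly_(i < N) f i.

Let trunc_mul N f g n : (n < N)%N ->
  ps_mul f g n = (trunc N f * trunc N g)`_n.
Proof.
move=> nN; rewrite coefM /=; apply: eq_bigr => i _.
rewrite !coef_poly (leq_trans (ltn_ord i) nN).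
by rewrite (leq_ltn_trans (leq_subr i n) nN).
Qed.

Let ps_mulC : commutative ps_mul.
Proof.
by move=> f g; apply/powserP => n; rewrite !(trunc_mul _ _ (ltnSn n)) mulrC.
Qed.

Let ps_mulA : associative ps_mul.
Proof.
move=> f g h; apply/powserP => n.
have E (a b : {poly F}) N : (n < N)%N -> (forall i, (i < N)%N -> a`_i = b`_i) ->
    forall c, (a * c)`_n = (b * c)`_n.
  move=> nN ab c; rewrite !coefM; apply: eq_bigr => i _.
  by rewrite ab// (leq_trans (ltn_ord i)).
have T a b : forall i, (i < n.+1)%N ->
    (trunc n.+1 (ps_mul a b))`_i = (trunc n.+1 a * trunc n.+1 b)`_i.
  by move=> i iN; rewrite coef_poly iN (trunc_mul _ _ iN).
rewrite !(trunc_mul _ _ (ltnSn n)) mulrC (E _ _ _ (ltnSn n) (T g h)).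
by rewrite (E _ _ _ (ltnSn n) (T f g)) mulrC mulrA.
Qed.

Let ps_mul1 : left_id (ps_const 1) ps_mul.
Proof.
move=> f; apply/powserP => n /=; rewrite big_ord_recl /= mul1r subn0 big1 ?addr0//.
by move=> i _; rewrite /= mul0r.
Qed.

Let ps_mulDl : left_distributive ps_mul ps_add.
Proof.
move=> f g h; apply/powserP => n /=; rewrite -big_split /=.
by apply: eq_bigr => i _; rewrite mulrDl.
Qed.

Let ps_one_neq0 : ps_const 1 != 0.
Proof.
by apply/eqP => /powserP /(_ 0%N); rewrite /= => /eqP; rewrite oner_eq0.
Qed.

HB.instance Definition _ := GRing.Zmodule_isComNzRing.Build (powser F)
  ps_mulA ps_mulC ps_mul1 ps_mulDl ps_one_neq0.

Definition psX : powser F := Powser (fun n => (n == 1%N)%:R).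
Definition ps_deriv f : powser F := Powser (fun n => f n.+1 *+ n.+1).

End PowerSeries.

(* O^dagger(K_m, t) and L^{+,dagger}_{K,infty}, as subrings of K_infty[[t]] *)
Section Overconvergent.
Variables (R : realType) (p : nat) (K : fieldType) (Kbar : closedFieldType).
Variables (iota : {rmorphism K -> Kbar}) (vp : Kbar -> \bar R).

Definition Odag (m : nat) : set (powser (Kinf p iota)) :=
  [set f | (forall n, Kcyc p iota m (Kinf_val (f n))) /\
           (0 < radius p vp (fun n => Kinf_val (f n)))%E].

Definition Ldag : set (powser (Kinf p iota)) := \bigcup_m Odag m.

End Overconvergent.

Section Modules.
Variables (A : comNzRingType) (M : lmodType A).

Definition is_basis (r : nat) (e : 'I_r -> M) : Prop :=
  forall x, exists! c : 'rV[A]_r, x = \sum_(i < r) c 0 i *: e i.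

Variable L : set A. (* a subring of A *)
Variable D : set M.

Definition is_submodule : Prop :=
  [/\ D 0, forall x y, D x -> D y -> D (x + y)
         & forall a x, L a -> D x -> D (a *: x)].

Definition is_finite_free : Prop :=
  exists (s : nat) (e : 'I_s -> M), (forall i, D (e i)) /\
    forall x, D x -> exists! c : 'rV[A]_s,
      (forall i, L (c 0 i)) /\ x = \sum_(i < s) c 0 i *: e i.

(* Elements of the tensor product of D and A over L are represented by formal
   sums of pure tensors x (x) a, identified by tensor_eq, the additive
   congruence generated by the defining relations. *)
Inductive tensor_eq :
  seq ({x : M | D x} * A) -> seq ({x : M | D x} * A) -> Prop :=
| tensor_refl s : tensor_eq s s
| tensor_sym s1 s2 : tensor_eq s1 s2 -> tensor_eq s2 s1
| tensor_trans s1 s2 s3 : tensor_eq s1 s2 -> tensor_eq s2 s3 -> tensor_eq s1 s3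
| tensor_cat s1 s2 s1' s2' :
    tensor_eq s1 s1' -> tensor_eq s2 s2' -> tensor_eq (s1 ++ s2) (s1' ++ s2')
| tensor_catC s1 s2 : tensor_eq (s1 ++ s2) (s2 ++ s1)
| tensor_0 x : tensor_eq [:: (x, 0)] [::]
| tensor_addr x a b : tensor_eq [:: (x, a + b)] [:: (x, a); (x, b)]
| tensor_addl x y z a : sval z = sval x + sval y ->
    tensor_eq [:: (z, a)] [:: (x, a); (y, a)]
| tensor_scale x z l a : L l -> sval z = l *: sval x ->
    tensor_eq [:: (z, a)] [:: (x, l * a)].

(* the natural map from the tensor product to M *)
Definition tensor_map (s : seq ({x : M | D x} * A)) : M :=
  \sum_(q <- s) q.2 *: sval q.1.

Definition tensor_map_iso : Prop :=
  (forall x, exists s, tensor_map s = x) /\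
  (forall s1 s2 : seq ({x : M | D x} * A),
     tensor_map s1 = tensor_map s2 -> tensor_eq s1 s2).

End Modules.

Definition is_stable_lattice (A : comNzRingType) (M : lmodType A) (L : set A)
    (phi : M -> M) (D : set M) : Prop :=
  [/\ is_submodule L D, is_finite_free L D, tensor_map_iso L D
    & forall x, D x -> D (phi x)].

Section Connections.
Variables (F : fieldType) (M : lmodType (powser F)).
Implicit Types phi : M -> M.

Definition is_connection phi : Prop :=
  (forall (c : F) x y,
     phi (ps_const c *: x + y) = ps_const c *: phi x + phi y) /\
  (forall f x, phi (f *: x) = (psX F * ps_deriv f) *: x + f *: phi x).

Definition is_regular_connection (r : nat) phi : Prop :=
  (exists e : 'I_r -> M, is_basis e) /\ is_connection phi.

(* N is the matrix of the map induced by phi on M / tM, in the basis given by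
   the classes of the e i. *)
Definition residue_matrix (r : nat) phi (e : 'I_r -> M) (N : 'M[F]_r) : Prop :=
  forall j, exists y : M,
    phi (e j) = \sum_(i < r) ps_const (N i j) *: e i + psX F *: y.

(* The lambda i are the eigenvalues, listed with multiplicity, of the map
   induced by phi on M / tM. *)
Definition has_exponents (E : fieldType) (inj : F -> E) (r : nat) phi
    (lambda : 'I_r -> E) : Prop :=
  exists (e : 'I_r -> M) (N : 'M[F]_r),
    [/\ is_basis e, residue_matrix phi e N
      & char_poly (map_mx inj N) = \prod_(i < r) ('X - (lambda i)%:P)].

End Connections.

(* Cohomology of the complex D --phi--> D, for D a phi-stable subgroup of M;
   elements of H^1 are cosets of phi(D) in D. *)
Section Cohomology.
Variables (M : zmodType) (phi : M -> M).
Implicit Type D : set M.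

Definition H0 D : set M := [set x | D x /\ phi x = 0].

Definition H1 D : set (set M) :=
  [set [set y + phi x | x in D] | y in D].

(* The inclusion of D in M sends y + phi(D) to y + phi(M). *)
Definition H1_map (C : set M) : set M :=
  [set y + phi x | y in C & x in [set: M]].

Definition RGamma_quasi_iso D : Prop :=
  set_bij (H0 D) (H0 [set: M]) id /\
  set_bij (H1 D) (H1 [set: M]) H1_map.

End Cohomology.

(* Main.v *)
(* In a basis, a regular connection is [theta + P] with [theta = t d/dt], and
   all three statements concern the equation [theta X + P X - X Q = Y] for
   matrices of power series: its coefficient of [t^k] reads
   [k X_k + P_0 X_k - X_k Q_0 = Z_k], with [Z_k] depending on the earlier [X_i],
   and this Sylvester operator is invertible for large [k], its eigenvalues
   being [k + lambda_i - mu_j].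

   Existence: a gauge transformation [G = 1 + O(t^(k0+1))] replaces [P] by its
   truncation at a large order [k0], a polynomial, whose coefficients lie in a
   single [K_m]; the transformed basis spans a stable lattice.

   Convergence (Clark): if [P], [Q], [Y] are overconvergent and the types of
   [mu_j - lambda_i] are positive, so is [X].  Cayley-Hamilton for [Q_0] bounds
   the inverse Sylvester operator by [C * prod_ij |k + lambda_i - mu_j|^-1], and
   the product of these bounds over [k <= n] grows at most exponentially in [n]:
   among the values [v (k + l)] one is at most linear in [n] because the type is
   positive, and the others add up to at most the valuation of a factorial.
   With [Q = 0] this compares the cohomologies; applied to the transition matrix
   of two lattices it shows that they coincide. *)

Require Import Defs.
From HB Require Import structures.
From mathcomp Require Import all_boot all_order all_algebra.
From mathcomp Require Import all_classical all_reals all_analysis.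
From mathcomp Require Import zify.

Set Implicit Arguments.
Unset Strict Implicit.
Unset Printing Implicit Defensive.

Import Order.TTheory GRing.Theory Num.Theory.
Import numFieldNormedType.Exports.
Local Open Scope classical_set_scope.
Local Open Scope ring_scope.

(** * Factorials, and uniform bounds over finite families *)

(** The sum is the valuation of [n!], given by Legendre's formula. It measures the total cost of the
    small divisors that are differences of integers. *)
Lemma sum_logn_le (p n : nat) : prime p ->
  (\sum_(k < n) logn p k.+1 <= n)%N.
Proof.
move=> pp; have -> : (\sum_(k < n) logn p k.+1 = logn p n`!)%N.
  elim: n => [|n IHn]; first by rewrite big_ord0 logn1.
  by rewrite big_ord_recr /= IHn factS lognM ?fact_gt0// addnC.
rewrite logn_fact//.
(* The extra term [n %/ p ^ j] pays for the next summand, since twice [n %/ p ^ j.+1] is at most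
   [n %/ p ^ j]. *)
suff H j : (\sum_(1 <= k < j.+1) n %/ p ^ k + n %/ p ^ j <= n)%N.
  by apply: leq_trans (H n); rewrite leq_addr.
elim: j => [|j IHj]; first by rewrite big_geq// add0n divn1.
rewrite big_nat_recr//= -addnA; apply: leq_trans IHj.
rewrite leq_add2l expnSr divnMA addnn -muln2.
apply: leq_trans (leq_mul (leqnn _) (prime_gt1 pp)) _.
exact: leq_divM.
Qed.

Lemma seq_unif (T : eqType) (s : seq T) (P : T -> nat -> Prop) :
  (forall x m n, (m <= n)%N -> P x m -> P x n) ->
  (forall x, x \in s -> exists n, P x n) ->
  exists n, forall x, x \in s -> P x n.
Proof.
move=> Pmon; elim: s => [|x s IH] Ps; first by exists 0%N.
have [m Pm] := Ps x (mem_head _ _).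
have [y ys|n Pn] := IH; first by apply: Ps; rewrite inE ys orbT.
exists (maxn m n) => y; rewrite inE => /orP[/eqP ->|ys].
  by apply: Pmon Pm; rewrite leq_maxl.
by apply: Pmon (Pn _ ys); rewrite leq_maxr.
Qed.

Lemma fin_unif (I : finType) (P : I -> nat -> Prop) :
  (forall i m n, (m <= n)%N -> P i m -> P i n) ->
  (forall i, exists n, P i n) -> exists n, forall i, P i n.
Proof.
move=> Pmon Pex; have [n Pn] := seq_unif (s := enum I) Pmon (fun i _ => Pex i).
by exists n => i; apply: Pn; rewrite mem_enum.
Qed.

(** * Valuations of field elements and of integers *)

Section Valuation.
Variables (R : realType) (F : fieldType) (v : F -> \bar R).
Hypothesis hv : is_valuation v.

(* [x] is at most [p^c] in absolute value. *)
Definition vge (c : nat) (x : F) : Prop := ((- c%:R)%:E <= v x)%E.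

Lemma val0 : v 0 = +oo%E.
Proof. by have [H _ _ _] := hv; apply/H. Qed.

Lemma valM x y : v (x * y) = (v x + v y)%E.
Proof. by have [_ _ H _] := hv. Qed.

Lemma val_fin_num x : x != 0 -> v x \is a fin_num.
Proof.
have [H0 Hm _ _] := hv; move=> x0; rewrite fin_numE; apply/andP; split.
  by apply/eqP/Hm.
by apply/eqP => /H0 /eqP; apply/negP.
Qed.

Lemma val1 : v 1 = 0%E.
Proof.
have := valM 1 1; rewrite mulr1; have /fineK <- := val_fin_num (oner_neq0 F).
move=> [] /eqP; rewrite -subr_eq0 opprD addrA subrr sub0r oppr_eq0 => /eqP ->.
by [].
Qed.

Lemma valV x : x != 0 -> v x^-1 = (- v x)%E.
Proof.
move=> x0; have xV0 : x^-1 != 0 by rewrite invr_eq0.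
have := valM x x^-1; rewrite divff// val1.
have /fineK <- := val_fin_num x0; have /fineK <- := val_fin_num xV0.
by move=> [] /eqP; rewrite eq_sym addr_eq0 => /eqP ->; rewrite -EFinN opprK.
Qed.

Lemma valN x : v (- x) = v x.
Proof.
suff N1 : v (-1) = 0%E by rewrite -mulN1r valM N1 add0e.
have := valM (-1) (-1); rewrite mulrNN mulr1 val1.
have N10 : (-1 : F) != 0 by rewrite oppr_eq0 oner_neq0.
have /fineK <- := val_fin_num N10.
by move=> [] /eqP; rewrite eq_sym -mulr2n mulrn_eq0 /= => /eqP ->.
Qed.

Lemma valD_ge a x y : (a <= v x)%E -> (a <= v y)%E -> (a <= v (x + y))%E.
Proof.
move=> ax ay; have [_ _ _ H] := hv; apply: le_trans (H x y).
by rewrite le_min ax ay.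
Qed.

Lemma val_nat_ge0 n : (0 <= v n%:R)%E.
Proof.
elim: n => [|n IHn]; first by rewrite val0.
by rewrite -natr1; apply: valD_ge => //; rewrite val1.
Qed.

Lemma vgeW a b x : (a <= b)%N -> vge a x -> vge b x.
Proof. by move=> ab; apply: le_trans; rewrite lee_fin lerN2 ler_nat. Qed.

Lemma vge0 c : vge c 0.
Proof. by rewrite /vge val0 leey. Qed.

Lemma vge_nat c n : vge c n%:R.
Proof.
by apply: le_trans (val_nat_ge0 n); rewrite lee_fin oppr_le0.
Qed.

Lemma vgeN c x : vge c x -> vge c (- x).
Proof. by rewrite /vge valN. Qed.

Lemma vgeD c x y : vge c x -> vge c y -> vge c (x + y).
Proof. exact: valD_ge. Qed.

Lemma vge_sum c I (r : seq I) (P : pred I) (E : I -> F) :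
  (forall i, P i -> vge c (E i)) -> vge c (\sum_(i <- r | P i) E i).
Proof. by move=> H; elim/big_ind: _ => //; [exact: vge0|exact: vgeD]. Qed.

Lemma vgeM a b x y : vge a x -> vge b y -> vge (a + b) (x * y).
Proof.
move=> ax by_; rewrite /vge valM natrD opprD EFinD.
exact: leeD.
Qed.

Lemma vge_prod (I : eqType) (r : seq I) (c : I -> nat) (E : I -> F) :
  (forall i, i \in r -> vge (c i) (E i)) ->
  vge (\sum_(i <- r) c i) (\prod_(i <- r) E i).
Proof.
move=> H; rewrite !big_seq; elim/big_rec2: _ => [|i x y ir IH].
  exact: (vge_nat 0 1).
by apply: vgeM => //; apply: H.
Qed.

Lemma vge_exists x : exists c, vge c x.
Proof.
have [->|x0] := eqVneq x 0; first by exists 0%N; exact: vge0.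
rewrite /vge; have /fineK <- := val_fin_num x0.
exists (Num.bound `|fine (v x)|); rewrite lee_fin lerNl.
apply: le_trans (ltW (archi_boundP (normr_ge0 _))).
by rewrite -normrN ler_norm.
Qed.

(** With the convention [0^-1 = 0], a vanishing [x] satisfies every bound on its inverse; bounds on
    [(k + l)^-1] thus tolerate an index where [k + l = 0]. *)
Lemma vgeVP c x : vge c x^-1 <-> x = 0 \/ (v x <= c%:R%:E)%E.
Proof.
have [->|x0] := eqVneq x 0.
  by rewrite invr0; split=> [_|_]; [left|exact: vge0].
rewrite /vge valV// EFinN leeN2; split=> [|[/eqP|//]]; first by right.
by rewrite (negbTE x0).
Qed.

Section ResidueCharacteristic.
Variable p : nat.
Hypotheses (pp : prime p) (vp1 : v p%:R = 1%E).

(** The part of [n] prime to [p] has valuation 0: otherwise its Bezout relation with [p] would give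
    1 a positive valuation. *)
Lemma val_natE n : (0 < n)%N -> v n%:R = (logn p n)%:R%:E.
Proof.
move=> n0; rewrite {1}(_ : n = (n %/ p ^ logn p n * p ^ logn p n)%N); last first.
  by rewrite divnK// pfactor_dvdnn.
set m := (n %/ _)%N.
have cop : coprime m p.
  have [//] := pfactor_coprime pp n0 => m' cm' E.
  have -> : m = m' by rewrite /m {1}E mulnK// expn_gt0 prime_gt0.
  by rewrite coprime_sym.
have m0 : (0 < m)%N by rewrite divn_gt0 ?pfactor_gt0// dvdn_leq// pfactor_dvdnn.
have vX a : v (p%:R ^+ a) = a%:R%:E.
  elim: a => [|a IHa]; first by rewrite expr0 val1.
  by rewrite exprS valM IHa vp1 -natr1 EFinD addeC.
rewrite natrM valM natrX vX (_ : v m%:R = 0%E) ?add0e//.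
apply/eqP; rewrite eq_le val_nat_ge0 andbT leNgt; apply/negP => vm.
case: (egcdnP p m0) => a b E _.
have gt0 k l : (0 < v l%:R -> 0 < v (k * l)%:R)%E.
  by move=> l0; rewrite natrM valM addeC; apply: lt_le_trans l0 _;
     rewrite leeDl ?val_nat_ge0.
have : (0 < Order.min (v (a * m)%:R) (v (- (b * p)%:R)))%E.
  by rewrite lt_min valN !gt0// vp1.
have [_ _ _ H] := hv; move=> /lt_le_trans/(_ (H _ _)).
by rewrite E (eqP cop) natrD addrAC subrr add0r val1 ltxx.
Qed.

(** Characteristic zero follows from [v p = 1]: positive integers have finite valuation. *)
Lemma natr_neq0 n : (0 < n)%N -> n%:R != 0 :> F.
Proof.
by move=> n0; apply/eqP => E; have := val_natE n0; rewrite E val0.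
Qed.

(* Away from an index [ks] maximising [v (k + l)], the ultrametric inequality
   gives [v (k + l) <= v (k - ks)], so the total cost is that of a factorial. *)
Lemma small_divisors (l : F) (c n : nat) :
  (forall k, (k <= n)%N -> vge c (k%:R + l)^-1) ->
  exists d : nat -> nat, (\sum_(k < n.+1) d k <= c + n)%N /\
    forall k, (k <= n)%N -> vge (d k) (k%:R + l)^-1.
Proof.
move=> hc.
have [ks ksn hks] : exists2 ks : nat, (ks <= n)%N &
    forall k, (k <= n)%N -> (v (k%:R + l) <= v (ks%:R + l))%E.
  case: (@arg_maxP _ _ _ ord0 xpredT (fun k : 'I_n.+1 => v ((k : nat)%:R + l)))
    => //= ks _ H; exists ks; first by rewrite -ltnS.
  by move=> k; rewrite -ltnS => kn; exact: (H (Ordinal kn)).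
(* By truncated subtraction, [(k - ks) + (ks - k)] is the distance from [k] to [ks]. *)
exists (fun k => if k == ks then c else logn p ((k - ks) + (ks - k))%N); split.
  rewrite -(big_mkord xpredT
    (fun k => if k == ks then c else logn p ((k - ks) + (ks - k))%N)).
  rewrite (@big_cat_nat _ _ _ ks)//=; last exact: leqW.
  rewrite (big_ltn (m := ks))// eqxx.
  (* Below [ks] the distances run through [1..ks], above it through [1..n - ks]. Both sums are
     valuations of factorials, and [ks] itself costs [c]. *)
  have A : (\sum_(0 <= i < ks)
      (if i == ks then c else logn p (i - ks + (ks - i))) <= ks)%N.
    apply: leq_trans (sum_logn_le ks pp).
    rewrite big_nat_rev /= big_mkord; apply: leq_sum => i _.
    have -> : (0 + ks - i.+1 == ks)%N = false by have := ltn_ord i; lia.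
    by rewrite leq_eqVlt; apply/orP; left; apply/eqP; congr logn; have := ltn_ord i; lia.
  have B : (\sum_(ks.+1 <= i < n.+1)
      (if i == ks then c else logn p (i - ks + (ks - i))) <= n - ks)%N.
    apply: leq_trans (sum_logn_le (n - ks) pp).
    rewrite -{1}[ks.+1]add0n big_addn subSS big_mkord; apply: leq_sum => i _.
    have -> : (i + ks.+1 == ks)%N = false by lia.
    by rewrite leq_eqVlt; apply/orP; left; apply/eqP; congr logn; lia.
  lia.
move=> k kn; case: eqP => [_|/eqP kks]; first exact: hc.
apply/vgeVP; right; rewrite -val_natE; last by lia.
have -> : v (k - ks + (ks - k))%:R = v ((k%:R + l) - (ks%:R + l)).
  rewrite opprD addrACA subrr addr0.
  have [kk|kk] := leqP k ks.
    rewrite (_ : k - ks = 0)%N ?add0n; last by lia.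
    by rewrite natrB// -valN opprB.
  rewrite (_ : ks - k = 0)%N ?addn0; last by lia.
  by rewrite natrB// ltnW.
by apply: valD_ge => //; rewrite valN hks.
Qed.

End ResidueCharacteristic.
End Valuation.

(** * Positive radius of convergence as an exponential growth bound *)

Section Radius.
Variables (R : realType) (F : fieldType) (v : F -> \bar R) (p : nat).
Hypotheses (hv : is_valuation v) (p_gt1 : (1 < p)%N).

Lemma vge_vabs c x : vge v c x <-> vabs p v x <= p%:R ^+ c.
Proof.
have p0 : (0 : R) < p%:R by rewrite ltr0n ltnW.
rewrite /vabs; have [->|x0] := eqVneq x 0.
  by split=> _; [rewrite exprn_ge0// ltW|exact: vge0].
rewrite /vge; have /fineK {1}<- := val_fin_num hv x0.
rewrite lee_fin lerNl -powR_mulrn ?(ltW p0)//; split=> H.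
  by apply: ler_powR => //; rewrite ler1n ltnW.
move: H; rewrite -ler_ln ?posrE ?powR_gt0// !ln_powR ler_pM2r//.
by rewrite ln_gt0// ltr1n.
Qed.

(** The factor [n.+1], instead of [n], lets the same constant absorb the coefficient at [n = 0]. *)
Lemma radius_gt0P (a : nat -> F) :
  (0 < Defs.radius p v a)%E <-> exists c, forall n, vge v (c * n.+1) (a n).
Proof.
have p0 : (0 : R) < p%:R by rewrite ltr0n ltnW.
split=> [/ereal_sup_gt[_ [r [r0 /cvgrPdist_lt/(_ 1 ltr01)[N _ hN]] <-]]|[c hc]].
  rewrite lte_fin => {}r0.
  pose c := Num.bound r^-1.
  have rc : r^-1 <= p%:R ^+ c.
    have /ltW/le_trans -> // : r^-1 < c%:R by apply: archi_boundP; rewrite invr_ge0 ltW.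
    by rewrite -natrX ler_nat ltnW// ltn_expl.
  (* The terms before [N] are not controlled by convergence, but they are finitely many. *)
  have [c' hc'] : exists c', forall i : 'I_N, vge v c' (a i).
    apply: fin_unif => [i m n|i]; [exact: vgeW | exact: vge_exists].
  exists (c + c')%N => n; have [Nn|nN] := leqP N n; last first.
    by apply: vgeW (hc' (Ordinal nN)); nia.
  apply: (@vgeW _ _ v (c * n)%N); first by nia.
  apply/vge_vabs; rewrite exprM.
  have := hN n Nn; rewrite /= sub0r normrN => /(le_lt_trans (ler_norm _)).
  rewrite -ltr_pdivlMr ?exprn_gt0// => /ltW/le_trans; apply.
  by rewrite mul1r -exprVn lerXn2r// nnegrE ?invr_ge0 ?exprn_ge0// ltW.
(* At radius [p^-(c+1)] the [n]-th term is at most [p^(c - n)]. *)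
apply: (@lt_le_trans _ _ ((p%:R ^- c.+1)%:E : \bar R)).
  by rewrite lte_fin invr_gt0 exprn_gt0.
apply: ereal_sup_ubound; exists (p%:R ^- c.+1) => //; split.
  by rewrite invr_ge0 exprn_ge0// ltW.
have g0 : geometric (p%:R ^+ c) (p%:R^-1 : R) @ \oo --> (0 : R).
  apply: cvg_geometric; rewrite ger0_norm ?invr_ge0 ?(ltW p0)//.
  by rewrite invf_lt1// ltr1n.
apply: (@squeeze_cvgr _ _ _ _ (fun=> 0)) g0; last exact: cvg_cst.
near=> n; have q0 : 0 <= (p%:R ^- c.+1 : R) ^+ n.
  by rewrite exprn_ge0// invr_ge0 exprn_ge0// ltW.
apply/andP; split.
  rewrite mulr_ge0//.
  by rewrite /vabs; case: ifP => // _; rewrite powR_ge0.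
apply: le_trans (ler_wpM2r q0 _) _; first exact/vge_vabs/(hc n).
rewrite /geometric /= mulnS exprD exprM exprS invfM exprMn mulrAC -mulrA.
rewrite -mulrA -exprMn mulVf ?expr1n ?mulr1//.
by rewrite expf_neq0// gt_eqF.
Unshelve. all: by end_near. Qed.

End Radius.

(** * Bounds for products, determinants and adjugates of matrices *)

Section MatrixBounds.
Variables (R : realType) (F : fieldType) (v : F -> \bar R).
Hypothesis hv : is_valuation v.

Definition mge (c m n : nat) (A : 'M[F]_(m, n)) : Prop :=
  forall i j, vge v c (A i j).

Lemma mgeW (a b m n : nat) (A : 'M[F]_(m, n)) : (a <= b)%N -> mge a A -> mge b A.
Proof. by move=> ab aA i j; apply: vgeW (aA i j). Qed.

Lemma mgeN (c m n : nat) (A : 'M[F]_(m, n)) : mge c A -> mge c (- A).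
Proof. by move=> cA i j; rewrite mxE; apply: vgeN. Qed.

Lemma mgeD (c m n : nat) (A B : 'M[F]_(m, n)) : mge c A -> mge c B -> mge c (A + B).
Proof. by move=> cA cB i j; rewrite mxE; apply: vgeD. Qed.

Lemma mge_sum (c m n : nat) I (r : seq I) (P : pred I) (A : I -> 'M[F]_(m, n)) :
  (forall i, P i -> mge c (A i)) -> mge c (\sum_(i <- r | P i) A i).
Proof.
move=> H; elim/big_ind: _ => //; last by move=> *; exact: mgeD.
by move=> i j; rewrite mxE; exact: vge0.
Qed.

Lemma mgeM (a b m n q : nat) (A : 'M[F]_(m, n)) (B : 'M[F]_(n, q)) :
  mge a A -> mge b B -> mge (a + b) (A *m B).
Proof. by move=> aA bB i j; rewrite mxE; apply: vge_sum => // k _; apply: vgeM. Qed.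

Lemma mge_exists (m n : nat) (A : 'M[F]_(m, n)) : exists c, mge c A.
Proof.
have [c hc] : exists c, forall ij : 'I_m * 'I_n, vge v c (A ij.1 ij.2).
  by apply: fin_unif => [i a b|i]; [exact: vgeW|exact: vge_exists].
by exists c => i j; apply: (hc (i, j)).
Qed.

Lemma vge_sign c (n : nat) : vge v c ((-1) ^+ n).
Proof.
rewrite -signr_odd; case: odd; first exact/(vgeN hv)/(vge_nat hv c 1).
exact: (vge_nat hv c 1).
Qed.

Lemma vge_det (c n : nat) (A : 'M[F]_n) : mge c A -> vge v (n * c) (\det A).
Proof.
move=> cA; apply: vge_sum => // s _; rewrite -[(n * c)%N]add0n.
apply: vgeM => //; first exact: vge_sign.
rewrite -[X in (X * _)%N]card_ord -sum_nat_const.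
by apply: vge_prod.
Qed.

Lemma mge_adj (c n : nat) (A : 'M[F]_n) : mge c A -> mge (n * c) (\adj A).
Proof.
move=> cA i j; rewrite mxE /cofactor -[(n * c)%N]add0n.
apply: vgeM => //; first exact: vge_sign.
apply: (vgeW (a := n.-1 * c)); first by rewrite leq_mul2r leq_pred orbT.
by apply: vge_det => a b; rewrite !mxE.
Qed.

(** Cramer's rule: [d] pays for the inverse determinant, [m * c] for the adjugate, [z] for the
    right-hand side. *)
Lemma mge_solve (c d z m n : nat) (C : 'M[F]_m) (X W : 'M[F]_(m, n)) :
  C *m X = W -> \det C != 0 -> mge c C -> vge v d (\det C)^-1 -> mge z W ->
  mge (d + (m * c + z)) X.
Proof.
move=> CX C0 cC dC zW.
have -> : X = (\det C)^-1 *: (\adj C *m W).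
  by rewrite -CX mulmxA mul_adj_mx mul_scalar_mx scalerA mulVf// scale1r.
move=> i j; rewrite mxE; apply: vgeM => //.
by apply: mgeM => //; apply: mge_adj.
Qed.

End MatrixBounds.

(** * The Sylvester operator: injectivity, bounds and rationality *)

Section Sylvester.
Variable F : fieldType.

Lemma horner_char_poly (n : nat) (P : 'M[F]_n) (x : F) :
  (char_poly P).[x] = \det (x%:M - P).
Proof.
rewrite -horner_evalE -det_map_mx; congr (\det _).
apply/matrixP => i j; rewrite !mxE /= /horner_eval !hornerE.
by case: eqP => _; rewrite ?mulr1n ?mulr0n !hornerE.
Qed.

(** When [mus] lists the eigenvalues of [Q], this is the characteristic polynomial of [Q] evaluated
    at [Q]. *)
Definition shift_prod (n : nat) (Q : 'M[F]_n) (mus : seq F) : 'M[F]_n :=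
  foldr (fun mu A => (Q - mu%:M) *m A) 1%:M mus.

Lemma shift_prod_char_poly (n : nat) (Q : 'M[F]_n) (mus : seq F) :
  char_poly Q = \prod_(mu <- mus) ('X - mu%:P) -> shift_prod Q mus = 0.
Proof.
(* Square matrices form a nontrivial ring only in positive size, so size 0 is treated apart. *)
case: n Q => [|n] Q E; first by apply/matrixP => -[].
rewrite -(Cayley_Hamilton Q) E {E}; elim: mus => [|mu mus IH].
  by rewrite big_nil rmorph1.
by rewrite big_cons rmorphM rmorphB /= horner_mx_X horner_mx_C IH.
Qed.

Variables m n : nat.
Implicit Types (P : 'M[F]_m) (Q : 'M[F]_n) (X : 'M[F]_(m, n)).

Definition syl (k : nat) P Q X : 'M[F]_(m, n) :=
  k%:R *: X + P *m X - X *m Q.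

Lemma syl_is_linear k P Q : linear (syl k P Q).
Proof.
move=> a X Y; rewrite /syl mulmxDr mulmxDl -scalemxAr -scalemxAl scalerDr.
rewrite scalerA [k%:R * a]mulrC -scalerA addrACA opprD [LHS]addrACA.
by rewrite -scalerDr -scalerBr.
Qed.

HB.instance Definition _ k P Q :=
  GRing.isLinear.Build F 'M[F]_(m, n) 'M[F]_(m, n) _ (syl k P Q)
    (syl_is_linear k P Q).

(** Recovers [X] from [X *m (Q - mu%:M)] and the image of [X], provided [mu - k] is not an
    eigenvalue of [P]. Iterated over the eigenvalues of [Q], this inverts [syl], because
    [shift_prod] vanishes. *)
Lemma syl_shift k P Q X (mu : F) :
  ((mu - k%:R)%:M - P) *m X = - (X *m (Q - mu%:M) + syl k P Q X).
Proof.
rewrite /syl mulmxBl mul_scalar_mx mulmxBr mul_mx_scalar scalerBl.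
set U := k%:R *: X; set W := X *m Q; set V := _ + P *m X.
have -> : W - mu *: X + (V - W) = V - mu *: X by rewrite addrC addrA subrK.
by rewrite opprB /V opprD addrA.
Qed.

Lemma syl_mulr k P Q X (A : 'M[F]_n) : comm_mx Q A ->
  syl k P Q (X *m A) = syl k P Q X *m A.
Proof.
by move=> QA; rewrite /syl mulmxBl mulmxDl -scalemxAl !mulmxA -!(mulmxA X) QA.
Qed.

Lemma comm_shift Q (mu : F) : comm_mx Q (Q - mu%:M).
Proof. by rewrite /comm_mx mulmxBr mulmxBl scalar_mxC. Qed.

(** Induction on [mus]: [X *m (Q - mu%:M)] also lies in the kernel and needs one factor less, so it
    vanishes; then [syl_shift] leaves an invertible matrix killing [X]. *)
Lemma syl_inj k P Q X (mus : seq F) :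
  (forall mu, mu \in mus -> \det ((mu - k%:R)%:M - P) != 0) ->
  X *m shift_prod Q mus = 0 -> syl k P Q X = 0 -> X = 0.
Proof.
elim: mus X => [|mu mus IH] X; first by rewrite /= mulmx1.
move=> hdet; rewrite /= mulmxA => X0 sX0.
have X'0 : X *m (Q - mu%:M) = 0.
  apply: IH => // [nu nus|]; first by apply: hdet; rewrite inE nus orbT.
  by rewrite syl_mulr ?sX0 ?mul0mx//; exact: comm_shift.
have := syl_shift k P Q X mu; rewrite X'0 sX0 addr0 oppr0.
set C := _ - P => CX; have : \adj C *m (C *m X) = 0 by rewrite CX mulmx0.
rewrite mulmxA mul_adj_mx mul_scalar_mx => /eqP.
by rewrite scaler_eq0 (negbTE (hdet _ (mem_head _ _))) => /eqP.
Qed.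

(** Quantitative form of the induction in [syl_inj]. Each [mu] costs [q] for multiplying by
    [Q - mu], then [D mu] and [m * c] for Cramer's rule. *)
Lemma syl_bound (R : realType) (v : F -> \bar R) (hv : is_valuation v)
    (c q k : nat) P Q (mus : seq F) (D : F -> nat) :
  (forall mu, mu \in mus ->
    [/\ \det ((mu - k%:R)%:M - P) != 0, mge v c ((mu - k%:R)%:M - P),
        vge v (D mu) (\det ((mu - k%:R)%:M - P))^-1 & mge v q (Q - mu%:M)]) ->
  forall z X, X *m shift_prod Q mus = 0 -> mge v z (syl k P Q X) ->
  mge v (z + \sum_(mu <- mus) (D mu + m * c + q)) X.
Proof.
elim: mus => [|mu mus IH] hyp z X.
  by rewrite /= mulmx1 => -> _ i j; rewrite mxE; exact: vge0.
rewrite /= mulmxA => X0 hz; have [d0 hc hD hq] := hyp mu (mem_head _ _).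
have hX' : mge v (z + q + \sum_(mu <- mus) (D mu + m * c + q)) (X *m (Q - mu%:M)).
  apply: IH => // [nu nus|]; first by apply: hyp; rewrite inE nus orbT.
  by rewrite syl_mulr; [exact: mgeM|exact: comm_shift].
rewrite big_cons; set s := (\sum_(j <- mus) _)%N in hX' *.
have -> : (z + (D mu + m * c + q + s) = D mu + (m * c + (z + q + s)))%N by lia.
apply: mge_solve (syl_shift k P Q X mu) _ _ _ _ => //.
apply/mgeN => //; apply: mgeD => //; apply: mgeW hz; lia.
Qed.

Section Rational.
Variables (S : divringClosed F).

Lemma det_over (l : nat) (A : 'M[F]_l) :
  (forall i j, A i j \in S) -> \det A \in S.
Proof.
move=> AS; apply: rpred_sum => s _; apply: rpredM.
  by rewrite rpredX ?rpredN ?rpred1.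
by apply: rpred_prod.
Qed.

Lemma invmx_over (l : nat) (A : 'M[F]_l) :
  (forall i j, A i j \in S) -> forall i j, invmx A i j \in S.
Proof.
(* By convention [invmx] of a singular matrix is the matrix itself. *)
move=> AS i j; rewrite /invmx; case: ifP => // _; rewrite !mxE.
apply: rpredM; first by rewrite rpredV det_over.
rewrite /cofactor; apply: rpredM; first by rewrite rpredX ?rpredN ?rpred1.
by apply: det_over => a b; rewrite !mxE.
Qed.

End Rational.

Section Inverse.
Variable T : {linear 'M[F]_(m, n) -> 'M[F]_(m, n)}.
Hypothesis T_inj : forall X, T X = 0 -> X = 0.

Lemma lin_mx_unit : lin_mx T \in unitmx.
Proof.
rewrite -row_free_unit; apply: inj_row_free => u.
rewrite -{1}[u]vec_mxK mul_vec_lin => /eqP; rewrite mxvec_eq0 => /eqP/T_inj.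
by move/(congr1 mxvec); rewrite vec_mxK linear0.
Qed.

Lemma lin_mx_solve X Z : T X = Z <-> X = vec_mx (mxvec Z *m invmx (lin_mx T)).
Proof.
split=> [<-|->].
  by rewrite -mul_vec_lin mulmxK ?lin_mx_unit// mxvecK.
by apply: (can_inj mxvecK); rewrite -mul_vec_lin vec_mxK mulmxKV// lin_mx_unit.
Qed.

(** The matrix of [T] has as entries those of the images of elementary matrices, which lie in [S];
    so does its inverse, by the adjugate formula. This keeps solutions inside one [K_m]. *)
Lemma lin_mx_over (S : divringClosed F) :
  (forall X, (forall i j, X i j \in S) -> forall i j, T X i j \in S) ->
  forall X, (forall i j, T X i j \in S) -> forall i j, X i j \in S.
Proof.
move=> TS X TXS i j; have /lin_mx_solve -> := erefl (T X).
rewrite mxE mxE; apply: rpred_sum => /= k _; apply: rpredM.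
  by case/mxvec_indexP: k => a b; rewrite mxvecE.
apply: invmx_over => {i j k} i j; rewrite !mxE /=.
case/mxvec_indexP: i => a b; case/mxvec_indexP: j => a' b'.
rewrite vec_mx_delta mxvecE; apply: TS => i j; rewrite mxE.
by rewrite rpred_nat.
Qed.

End Inverse.
End Sylvester.

(** * Recursive solution of linear differential equations over power series *)

(** Since [step k] reads only the values below [k], the value at [k] is stationary after [k.+1]
    rounds of iteration. *)
Lemma strong_rec (T : Type) (t0 : T) (step : nat -> (nat -> T) -> T) :
  (forall k f g, (forall i, (i < k)%N -> f i = g i) -> step k f = step k g) ->
  exists f, forall k, f k = step k f.
Proof.
move=> hstep; pose g n := iter n (fun f k => step k f) (fun=> t0).
have gE k : forall m n, (k < m)%N -> (k < n)%N -> g m k = g n k.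
  elim/ltn_ind: k => k IH [|m] [|n]//= km kn.
  by apply: hstep => i ik; apply: IH => //; lia.
exists (fun k => g k.+1 k) => k; apply: hstep => i ik.
by apply: gE; lia.
Qed.

Section PowserMatrix.
Variable F : fieldType.

Definition theta (f : powser F) : powser F := psX F * ps_deriv f.

Lemma ps_sumE I (r : seq I) (P : pred I) (f : I -> powser F) k :
  (\sum_(i <- r | P i) f i) k = \sum_(i <- r | P i) f i k.
Proof. exact: (big_morph (fun g : powser F => g k)). Qed.

Lemma ps_mulE (f g : powser F) k : (f * g) k = \sum_(i < k.+1) f i * g (k - i)%N.
Proof. by []. Qed.

Lemma thetaE f k : theta f k = f k *+ k.
Proof.
rewrite ps_mulE; case: k => [|k].
  by rewrite big_ord1 /= mul0r mulr0n.
rewrite big_ord_recl /= mul0r add0r big_ord_recl /= mul1r subn1 /=.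
by rewrite big1 ?addr0// => i _; rewrite mul0r.
Qed.

Definition cf (k m n : nat) (X : 'M[powser F]_(m, n)) : 'M[F]_(m, n) :=
  map_mx (fun f : powser F => f k) X.

Definition mkps (m n : nat) (X : nat -> 'M[F]_(m, n)) : 'M[powser F]_(m, n) :=
  \matrix_(i, j) Powser (fun k => X k i j).

Lemma cf_mkps k m n (X : nat -> 'M[F]_(m, n)) : cf k (mkps X) = X k.
Proof. by apply/matrixP => i j; rewrite !mxE. Qed.

Lemma cf_inj m n (X Y : 'M[powser F]_(m, n)) :
  (forall k, cf k X = cf k Y) -> X = Y.
Proof.
move=> XY; apply/matrixP => i j; apply/powserP => k.
by have /matrixP/(_ i j) := XY k; rewrite !mxE.
Qed.

Lemma cfD k m n (X Y : 'M[powser F]_(m, n)) : cf k (X + Y) = cf k X + cf k Y.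
Proof. by apply/matrixP => i j; rewrite !mxE. Qed.

Lemma cfN k m n (X : 'M[powser F]_(m, n)) : cf k (- X) = - cf k X.
Proof. by apply/matrixP => i j; rewrite !mxE. Qed.

Lemma cf1 k n : cf k (1%:M : 'M[powser F]_n) = (k == 0%N)%:R%:M.
Proof.
apply/matrixP => i j; by rewrite !mxE; case: (i == j).
Qed.

Lemma cfM k m n q (X : 'M[powser F]_(m, n)) (Y : 'M[powser F]_(n, q)) :
  cf k (X *m Y) = \sum_(i < k.+1) cf i X *m cf (k - i) Y.
Proof.
apply/matrixP => a b; rewrite !mxE ps_sumE summxE.
under [RHS]eq_bigr do rewrite mxE.
rewrite exchange_big /=; apply: eq_bigr => j _.
by apply: eq_bigr => i _; rewrite !mxE.
Qed.

Lemma cfMr k m n q (X : 'M[powser F]_(m, n)) (Y : 'M[powser F]_(n, q)) :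
  cf k (X *m Y) = \sum_(i < k.+1) cf (k - i) X *m cf i Y.
Proof.
rewrite cfM (reindex_inj rev_ord_inj) /=; apply: eq_bigr => i _.
by rewrite subSS subKn// -ltnS.
Qed.

(** The connection on homomorphisms from [theta + Q] to [theta + P]: its kernel consists of the
    horizontal maps. For [Q = 0] of size 1 it is [theta + P] on column vectors. *)
Definition conn m n (P : 'M[powser F]_m) (Q : 'M[powser F]_n)
    (X : 'M[powser F]_(m, n)) : 'M[powser F]_(m, n) :=
  map_mx theta X + P *m X - X *m Q.

Definition conn_tail m n (P : 'M[powser F]_m) (Q : 'M[powser F]_n)
    (k : nat) (x : nat -> 'M[F]_(m, n)) : 'M[F]_(m, n) :=
  \sum_(i < k) (cf i.+1 P *m x (k - i.+1)%N - x (k - i.+1)%N *m cf i.+1 Q).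

Lemma cf_conn k m n (P : 'M[powser F]_m) (Q : 'M[powser F]_n) X :
  cf k (conn P Q X) = syl k (cf 0 P) (cf 0 Q) (cf k X)
    + conn_tail P Q k (fun i => cf i X).
Proof.
rewrite /conn !cfD cfN cfM cfMr !big_ord_recl /= subn0.
have -> : cf k (map_mx theta X) = k%:R *: cf k X.
  by apply/matrixP => i j; rewrite !mxE thetaE mulr_natl.
rewrite /syl /conn_tail sumrB opprD addrA [in LHS]addrA addrACA.
by rewrite -!addrA; congr (_ + (_ + _)); rewrite [in RHS]addrCA.
Qed.

Lemma connP m n (P : 'M[powser F]_m) (Q : 'M[powser F]_n) X Y :
  conn P Q X = Y <-> forall k, syl k (cf 0 P) (cf 0 Q) (cf k X) =
    cf k Y - conn_tail P Q k (fun i => cf i X).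
Proof.
split=> [<- k|H]; first by rewrite cf_conn addrK.
by apply: cf_inj => k; rewrite cf_conn H subrK.
Qed.

Lemma conn_tail_ext m n (P : 'M[powser F]_m) (Q : 'M[powser F]_n) k x y :
  (forall i, (i < k)%N -> x i = y i) -> conn_tail P Q k x = conn_tail P Q k y.
Proof.
by move=> xy; apply: eq_bigr => i _; rewrite xy//; have := ltn_ord i; lia.
Qed.

(** Up to [k0], where [syl] may be singular, the coefficients are prescribed and must already
    satisfy the equation; each later coefficient is obtained by inverting [syl]. *)
Lemma conn_solve m n (P : 'M[powser F]_m) (Q : 'M[powser F]_n) Y (k0 : nat) X0 :
  (forall k, (k <= k0)%N -> syl k (cf 0 P) (cf 0 Q) (X0 k) =
     cf k Y - conn_tail P Q k X0) ->
  (forall k, (k0 < k)%N -> forall Z, syl k (cf 0 P) (cf 0 Q) Z = 0 -> Z = 0) ->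
  exists X, conn P Q X = Y /\ forall k, (k <= k0)%N -> cf k X = X0 k.
Proof.
move=> hX0 hinj.
have [|x xE] := @strong_rec _ 0 (fun k x => if (k <= k0)%N then X0 k else
    vec_mx (mxvec (cf k Y - conn_tail P Q k x) *m
            invmx (lin_mx (syl k (cf 0 P) (cf 0 Q))))).
  by move=> k f g fg; case: ifP => // _; rewrite (conn_tail_ext P Q fg).
have cfx : (fun i => cf i (mkps x)) = x by apply/funext => i; rewrite cf_mkps.
have x0 k : (k <= k0)%N -> x k = X0 k by move=> kk0; rewrite xE kk0.
exists (mkps x); split=> [|k kk0]; last by rewrite cf_mkps x0.
apply/connP => k; rewrite cf_mkps cfx; have [kk0|kk0] := leqP k k0.
  rewrite x0// hX0//; congr (_ - _); apply: conn_tail_ext => i ik.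
  by rewrite x0//; lia.
by apply/(lin_mx_solve (hinj k kk0)); rewrite xE leqNgt kk0.
Qed.

Lemma ps_mx_inv n (G : 'M[powser F]_n) : cf 0 G = 1%:M ->
  exists H, G *m H = 1%:M /\ H *m G = 1%:M.
Proof.
move=> G0; have [|h hE] := @strong_rec _ 0 (fun k h => (k == 0%N)%:R%:M -
    \sum_(i < k) cf i.+1 G *m h (k - i.+1)%N).
  move=> k f g fg; congr (_ - _); apply: eq_bigr => i _.
  by rewrite fg//; have := ltn_ord i; lia.
suff E : G *m mkps h = 1%:M by exists (mkps h); split=> //; exact: mulmx1C.
apply: cf_inj => k; rewrite cf1 cfM big_ord_recl G0 mul1mx subn0 cf_mkps hE.
rewrite -[RHS](subrK (\sum_(i < k) cf i.+1 G *m h (k - i.+1)%N)).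
by congr (_ + _); apply: eq_bigr => i _; rewrite cf_mkps.
Qed.

End PowserMatrix.

(** * The embedding of [K_infty] and its subfields [K_m] *)

Section KinfMorphism.
Variables (p : nat) (K : fieldType) (Kbar : closedFieldType).
Variable (iota : {rmorphism K -> Kbar}).

HB.instance Definition _ :=
  GRing.RMorphism.copy (@Kinf_val p K Kbar iota) (\val : Kinf p iota -> Kbar).

Lemma Kinf_Kcyc (x : Kinf p iota) : exists m, Kcyc p iota m (Kinf_val x).
Proof. by case: x => x /= /asboolP. Qed.

Definition Kcyc_pred (m : nat) : {pred Kinf p iota} :=
  fun x => `[< Kcyc p iota m (Kinf_val x) >].

Lemma Kcyc_predP m x : reflect (Kcyc p iota m (Kinf_val x)) (x \in Kcyc_pred m).
Proof. exact: asboolP. Qed.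

Lemma Kcyc_pred_divring m : divring_closed (Kcyc_pred m).
Proof.
have [K1 KB KV] := Kcyc_subfield p iota m.
split=> [|x y|x y]; first by apply/Kcyc_predP; rewrite rmorph1.
  by move=> /Kcyc_predP xK /Kcyc_predP yK; apply/Kcyc_predP; rewrite rmorphB; apply: KB.
by move=> /Kcyc_predP xK /Kcyc_predP yK; apply/Kcyc_predP; rewrite fmorph_div; apply: KV.
Qed.

HB.instance Definition _ m :=
  GRing.isDivringClosed.Build (Kinf p iota) (Kcyc_pred m) (Kcyc_pred_divring m).

End KinfMorphism.

Arguments Kcyc_pred {p K Kbar} iota m.

(** * The ring of overconvergent series and matrices over it *)

Section Overconvergent.
Variables (R : realType) (p : nat) (K : fieldType) (Kbar : closedFieldType).
Variables (iota : {rmorphism K -> Kbar}) (vp : Kbar -> \bar R).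
Hypotheses (pp : prime p) (hvp : is_valuation vp) (hvpp : vp p%:R = 1%E).

Local Notation F := (Kinf p iota).
Local Notation inj := (@Kinf_val p K Kbar iota).

(** One index bounds both the cyclotomic level and the growth, so that [Ldag] is an increasing union
    and finitely many series share an index. *)
Definition dag (N : nat) (f : powser F) : Prop :=
  forall n, f n \in Kcyc_pred iota N /\ vge vp (N * n.+1) (inj (f n)).

Lemma Kcyc_predW m n (x : F) : (m <= n)%N -> x \in Kcyc_pred iota m ->
  x \in Kcyc_pred iota n.
Proof. by move=> mn /Kcyc_predP xm; apply/Kcyc_predP; apply: Kcyc_le xm. Qed.

Lemma dagW M N (f : powser F) : (M <= N)%N -> dag M f -> dag N f.
Proof.
move=> MN fM n; have [fK fv] := fM n; split; first exact: Kcyc_predW fK.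
by apply: vgeW fv; rewrite leq_mul2r MN orbT.
Qed.

Lemma LdagP (f : powser F) : Ldag vp f <-> exists N, dag N f.
Proof.
split=> [[m _ [fK /(radius_gt0P hvp (prime_gt1 pp))[c fc]]]|[N fN]].
  exists (maxn m c) => n; split.
    by apply: (Kcyc_predW (leq_maxl m c)); apply/Kcyc_predP; exact: fK.
  by apply: vgeW (fc n); rewrite leq_mul2r leq_maxr orbT.
exists N => //; split=> [n|]; first by have [/Kcyc_predP] := fN n.
apply/(radius_gt0P hvp (prime_gt1 pp)); exists N => n.
by have [] := fN n.
Qed.

Lemma Kinf_unif (I : finType) (x : I -> F) :
  exists N, forall i, x i \in Kcyc_pred iota N /\ vge vp N (inj (x i)).
Proof.
apply: fin_unif => [i m n mn [xK xv]|i].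
  by split; [exact: Kcyc_predW xK|exact: vgeW xv].
have [m xm] := Kinf_Kcyc (x i); have [c xc] := vge_exists hvp (inj (x i)).
exists (maxn m c); split; last by apply: vgeW xc; rewrite leq_maxr.
by apply: (Kcyc_predW (leq_maxl m c)); apply/Kcyc_predP.
Qed.

Lemma Ldag_poly (f : powser F) k0 : (forall k, (k0 < k)%N -> f k = 0) -> Ldag vp f.
Proof.
move=> f0; apply/LdagP; have [N hN] := Kinf_unif (fun i : 'I_k0.+1 => f i).
exists N => n; have [nk|nk] := leqP n k0; last first.
  by rewrite f0// rpred0 rmorph0; split=> //; exact: vge0.
have [fK fv] := hN (Ordinal (nk : (n < k0.+1)%N)); split=> //.
by apply: vgeW fv; rewrite leq_pmulr.
Qed.

Lemma Ldag0 : Ldag vp (0 : powser F).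
Proof. exact: (@Ldag_poly _ 0). Qed.

Lemma Ldag1 : Ldag vp (1 : powser F).
Proof. by apply: (@Ldag_poly _ 0) => -[]. Qed.

Lemma LdagD (f g : powser F) : Ldag vp f -> Ldag vp g -> Ldag vp (f + g).
Proof.
move=> /LdagP[M fM] /LdagP[N gN]; apply/LdagP; exists (maxn M N) => n.
have [fK fv] := dagW (leq_maxl M N) fM n.
have [gK gv] := dagW (leq_maxr M N) gN n.
by split; [exact: rpredD|rewrite rmorphD; exact: vgeD].
Qed.

Lemma LdagN (f : powser F) : Ldag vp f -> Ldag vp (- f).
Proof.
move=> /LdagP[M fM]; apply/LdagP; exists M => n; have [fK fv] := fM n.
by split; [rewrite rpredN|rewrite rmorphN; exact: vgeN].
Qed.

Lemma LdagM (f g : powser F) : Ldag vp f -> Ldag vp g -> Ldag vp (f * g).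
Proof.
move=> /LdagP[M fM] /LdagP[N gN]; apply/LdagP.
exists (M + N + (M + N))%N => n; rewrite ps_mulE; split.
  apply: rpred_sum => i _; have [fK _] := fM i; have [gK _] := gN (n - i)%N.
  by apply: rpredM; [apply: Kcyc_predW fK|apply: Kcyc_predW gK]; lia.
rewrite rmorph_sum; apply: vge_sum => // i _; rewrite rmorphM.
have [_ fv] := fM i; have [_ gv] := gN (n - i)%N.
apply: vgeW (vgeM hvp fv gv).
have : (i <= n)%N by rewrite -ltnS.
nia.
Qed.

Lemma Ldag_theta (f : powser F) : Ldag vp f -> Ldag vp (theta f).
Proof.
move=> /LdagP[M fM]; apply/LdagP; exists M => n; have [fK fv] := fM n.
rewrite thetaE -mulr_natr; split; first by rewrite rpredM ?rpred_nat.
by rewrite rmorphM rmorph_nat -[(M * _)%N]addn0; apply: vgeM => //; exact: vge_nat.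
Qed.

Lemma Ldag_sum I (r : seq I) (P : pred I) (f : I -> powser F) :
  (forall i, P i -> Ldag vp (f i)) -> Ldag vp (\sum_(i <- r | P i) f i).
Proof. by move=> H; elim/big_ind: _ => //; [exact: Ldag0|exact: LdagD]. Qed.

Definition Lmx m n (X : 'M[powser F]_(m, n)) := forall i j, Ldag vp (X i j).

Lemma Lmx_unif m n (X : 'M[powser F]_(m, n)) : Lmx X ->
  exists N, forall k, (forall i j, cf k X i j \in Kcyc_pred iota N) /\
    mge vp (N * k.+1) (map_mx inj (cf k X)).
Proof.
move=> LX; have [N hN] : exists N, forall ij : 'I_m * 'I_n, dag N (X ij.1 ij.2).
  by apply: fin_unif => [i a b|i]; [exact: dagW|exact/LdagP/LX].
exists N => k; split=> i j; have [H1 H2] := hN (i, j) k.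
  by rewrite mxE; apply: H1.
by rewrite !mxE; apply: H2.
Qed.

Lemma LmxM m n q (X : 'M[powser F]_(m, n)) (Y : 'M[powser F]_(n, q)) :
  Lmx X -> Lmx Y -> Lmx (X *m Y).
Proof.
by move=> LX LY i j; rewrite mxE; apply: Ldag_sum => k _; apply: LdagM.
Qed.

Lemma map_syl m n k (P : 'M[F]_m) (Q : 'M[F]_n) X :
  map_mx inj (syl k P Q X) =
  syl k (map_mx inj P) (map_mx inj Q) (map_mx inj X).
Proof. by rewrite /syl map_mxB map_mxD !map_mxM map_mxZ rmorph_nat. Qed.

(** * Clark's estimate for the inverse Sylvester operators *)

Section Clark.
Variables (m n : nat) (P : 'M[F]_m) (Q : 'M[F]_n) (ls mus : seq Kbar).
Hypothesis hP : char_poly (map_mx inj P) = \prod_(l <- ls) ('X - l%:P).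
Hypothesis hQ : char_poly (map_mx inj Q) = \prod_(mu <- mus) ('X - mu%:P).

Lemma det_shiftE x : \det (x%:M - map_mx inj P) = \prod_(l <- ls) (x - l).
Proof.
rewrite -horner_char_poly hP horner_prod; apply: eq_bigr => l _.
by rewrite !hornerE.
Qed.

(** By characteristic zero each [mu - l] equals at most one natural number; beyond the largest of
    these no factor of the determinant vanishes. *)
Lemma nonresonant : exists k0, forall k, (k0 < k)%N ->
  forall mu, mu \in mus -> \det ((mu - k%:R)%:M - map_mx inj P) != 0.
Proof.
have H (z : Kbar) : exists k0, forall k, (k0 < k)%N -> z - k%:R != 0.
  have [[k zk]|nz] := pselect (exists k : nat, z = k%:R).
    exists k => k1 kk1; rewrite zk -opprB oppr_eq0 -natrB ?(ltnW kk1)//.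
    by apply: (natr_neq0 hvp pp hvpp); rewrite subn_gt0.
  exists 0%N => k _; apply/eqP => /eqP; rewrite subr_eq0 => /eqP zk.
  by apply: nz; exists k.
have [k0 hk0] : exists k0, forall mu, mu \in mus ->
    forall l, l \in ls -> forall k, (k0 < k)%N -> mu - l - k%:R != 0.
  apply: seq_unif => [mu a b ab ha l lls k bk|mu _].
    by apply: ha => //; apply: leq_ltn_trans bk.
  apply: seq_unif => [l a b ab ha k bk|l _]; last exact: H.
  by apply: ha; apply: leq_ltn_trans bk.
exists k0 => k kk0 mu hmu; rewrite det_shiftE prodf_seq_neq0; apply/allP => l hl.
by rewrite addrAC hk0.
Qed.

(** The eigenvalues live in [Kbar]; injectivity is proved there and descends along the embedding of
    [K_infty]. *)
Lemma syl_inj_large : exists k0, forall k, (k0 < k)%N ->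
  forall X, syl k P Q X = 0 -> X = 0.
Proof.
have [k0 hk0] := nonresonant; exists k0 => k kk0 X X0.
apply: (@map_mx_inj _ _ inj); rewrite map_mx0.
apply: (syl_inj (k := k) (P := map_mx inj P) (Q := map_mx inj Q) (mus := mus)).
- exact: hk0.
- by rewrite shift_prod_char_poly// mulmx0.
- by rewrite -map_syl X0 map_mx0.
Qed.

Hypothesis htype : forall l mu, l \in ls -> mu \in mus ->
  (0 < padic_type p vp (mu - l)%R)%E.

Lemma exponents_growth : exists C, forall l mu, l \in ls -> mu \in mus ->
  forall k, vge vp (C * k.+1) (k%:R + (l - mu))^-1.
Proof.
have [C hC] : exists C, forall l, l \in ls -> forall mu, mu \in mus ->
    forall k, vge vp (C * k.+1) (k%:R + (l - mu))^-1.
  have W a b (x : Kbar) k : (a <= b)%N -> vge vp (a * k.+1) x -> vge vp (b * k.+1) x.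
    by move=> ab; apply: vgeW; rewrite leq_mul2r ab orbT.
  apply: seq_unif => [l a b ab H mu hmu k|l hl]; first exact/(W _ _ _ _ ab)/H.
  apply: seq_unif => [mu a b ab H k|mu hmu]; first exact/(W _ _ _ _ ab)/H.
  have /(radius_gt0P hvp (prime_gt1 pp))[C hC] := htype hl hmu.
  exists C => k; have := hC k.
  (* The term omitted from the series of the type is coded as 0, in agreement with [0^-1 = 0]. *)
  have -> : (if mu - l == k%:R then 0 else (mu - l - k%:R)^-1) =
            - (k%:R + (l - mu))^-1.
    rewrite -invrN opprD opprB [- _ + _]addrC; case: eqP => // ->.
    by rewrite subrr invr0.
  by move=> /(vgeN hvp); rewrite opprK.
by exists C => l mu hl hmu; apply: hC.
Qed.

(* The costs [W] depend on [N], through the index maximising [v (k + l)]; only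
   the linear bound on their sum is uniform. *)
Lemma syl_growth : exists B, forall N, exists W : nat -> nat,
  (\sum_(k < N.+1) W k <= B * N.+1)%N /\
  forall k, (k <= N)%N ->
    (forall mu, mu \in mus -> \det ((mu - k%:R)%:M - map_mx inj P) != 0) ->
    forall z (X : 'M[Kbar]_(m, n)),
    mge vp z (syl k (map_mx inj P) (map_mx inj Q) X) -> mge vp (z + W k) X.
Proof.
have [C hC] := exponents_growth.
have [c hc] : exists c, forall mu, mu \in mus ->
    forall k : nat, mge vp c ((mu - k%:R)%:M - map_mx inj P).
  apply: seq_unif => [mu a b ab H k|mu _]; first exact: mgeW (H k).
  have [c hc] := mge_exists hvp (mu%:M - map_mx inj P); exists c => k.
  have -> : (mu - k%:R)%:M - map_mx inj P = mu%:M - map_mx inj P + - (k%:R%:M).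
    by rewrite raddfB /= addrAC.
  apply: mgeD => //; apply: mgeN => // i j; rewrite !mxE.
  by case: eqP => _; [exact: vge_nat|exact: vge0].
have [q hq] : exists q, forall mu, mu \in mus -> mge vp q (map_mx inj Q - mu%:M).
  apply: seq_unif => [mu a b ab H|mu _]; first exact: mgeW H.
  exact: mge_exists.
(* In [C.+1], the [C] pays for the worst index and the 1 for the factorial; [m * c] and [q] are paid
   at every [k]. *)
exists (\sum_(mu <- mus) (\sum_(l <- ls) C.+1 + m * c + q))%N => N.
(* The choice is made for all [z] in [Kbar]; where the growth bound fails, the zero function is a
   placeholder. *)
have /choice[d hd] (z : Kbar) : exists d : nat -> nat,
    (forall k, vge vp (C * k.+1) (k%:R + z)^-1) ->
    (\sum_(k < N.+1) d k <= C * N.+1 + N)%N /\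
    forall k, (k <= N)%N -> vge vp (d k) (k%:R + z)^-1.
  have [zC|nzC] := pselect (forall k, vge vp (C * k.+1) (k%:R + z)^-1); last first.
    by exists (fun=> 0%N).
  have [|d hd] := small_divisors hvp pp hvpp (l := z) (c := (C * N.+1)%N) (n := N).
    by move=> k kN; apply: vgeW (zC k); rewrite leq_mul2l ltnS kN orbT.
  by exists d.
exists (fun k => \sum_(mu <- mus) (\sum_(l <- ls) d (l - mu)%R k + m * c + q))%N.
split.
  rewrite exchange_big big_distrl /=; rewrite big_seq [leqRHS]big_seq.
  apply: leq_sum => mu hmu.
  rewrite !big_split /= !mulnDl !sum_nat_const card_ord.
  rewrite -addnA -[X in (_ <= X)%N]addnA; apply: leq_add; last by lia.
  rewrite exchange_big big_distrl /=; rewrite big_seq [leqRHS]big_seq.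
  apply: leq_sum => l hl.
  have [H _] := hd (l - mu) (hC l mu hl hmu).
  by apply: leq_trans H _; rewrite mulSn addnC leq_add2r.
move=> k kN hdet z X hz.
apply: (@syl_bound _ _ _ _ _ hvp c q k _ _ _
  (fun mu => (\sum_(l <- ls) d (l - mu)%R k)%N) _ _ _ _ hz).
  move=> mu hmu; split=> //; [exact: hdet|exact: hc| |exact: hq].
  rewrite det_shiftE -prodfV; apply: vge_prod => // l hl.
  have [_ /(_ k kN)/(vgeN hvp)] := hd (l - mu) (hC l mu hl hmu).
  by rewrite -invrN opprD opprB [- _ + _]addrC addrAC.
by rewrite shift_prod_char_poly// mulmx0.
Qed.

End Clark.

(** The two halves of overconvergence, coefficients in a single [K_N] and exponential growth, are
    proved by separate inductions on the order of the coefficient. *)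
Lemma conn_Lmx m n (P : 'M[powser F]_m) (Q : 'M[powser F]_n) X (ls mus : seq Kbar) :
  char_poly (map_mx inj (cf 0 P)) = \prod_(l <- ls) ('X - l%:P) ->
  char_poly (map_mx inj (cf 0 Q)) = \prod_(mu <- mus) ('X - mu%:P) ->
  (forall l mu, l \in ls -> mu \in mus -> (0 < padic_type p vp (mu - l)%R)%E) ->
  Lmx P -> Lmx Q -> Lmx (conn P Q X) -> Lmx X.
Proof.
move=> hP hQ htype LP LQ LY; set Y := conn P Q X in LY.
have [k0 hk0] := nonresonant mus hP.
have [k1 hk1] := syl_inj_large hP hQ.
have [B hB] := syl_growth hP hQ htype.
have [NP hNP] := Lmx_unif LP; have [NQ hNQ] := Lmx_unif LQ.
have [NY hNY] := Lmx_unif LY.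
(* Beyond [kk] the equation determines the coefficients; the finitely many others enter the bounds
   through [N0]. *)
pose kk := maxn k0 k1.
have [N0 hN0] := Kinf_unif (fun t : 'I_kk.+1 * ('I_m * 'I_n) => cf t.1 X t.2.1 t.2.2).
pose N := (NP + NQ + NY + N0)%N.
have /connP eqX := erefl (conn P Q X).
have rat k : forall i j, cf k X i j \in Kcyc_pred iota N.
  elim/ltn_ind: k => k IH; have [kkk|kkk] := leqP k kk.
    move=> i j; have [H _] := hN0 (Ordinal (kkk : (k < kk.+1)%N), (i, j)).
    by apply: Kcyc_predW H; rewrite /N; lia.
  have hP1 l i j : cf l P i j \in Kcyc_pred iota N.
    by apply: Kcyc_predW ((hNP l).1 i j); rewrite /N; lia.
  have hQ1 l i j : cf l Q i j \in Kcyc_pred iota N.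
    by apply: Kcyc_predW ((hNQ l).1 i j); rewrite /N; lia.
  have mulK a b c (U : 'M[F]_(a, b)) (V : 'M[F]_(b, c)) :
      (forall i j, U i j \in Kcyc_pred iota N) ->
      (forall i j, V i j \in Kcyc_pred iota N) ->
      forall i j, (U *m V) i j \in Kcyc_pred iota N.
    by move=> hU hV i j; rewrite mxE; apply: rpred_sum => t _; apply: rpredM.
  apply: (lin_mx_over (T := syl k (cf 0 P) (cf 0 Q))).
  - by apply: hk1; apply: leq_ltn_trans kkk; rewrite leq_maxr.
  - move=> Z hZ i j; rewrite /syl !mxE rpredB ?rpredD ?rpredM ?rpred_nat//.
      by have := mulK _ _ _ _ _ (hP1 0%N) hZ i j; rewrite mxE.
    by have := mulK _ _ _ _ _ hZ (hQ1 0%N) i j; rewrite mxE.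
  - move=> i j; rewrite /= eqX [in X in X \in _]mxE [X in _ + X]mxE.
    apply: rpredB; first by apply: Kcyc_predW ((hNY k).1 i j); rewrite /N; lia.
    rewrite /conn_tail summxE; apply: rpred_sum => t _; rewrite !mxE.
    have tk : (k - t.+1 < k)%N by have := ltn_ord t; lia.
    apply: rpredB.
      by have := mulK _ _ _ _ _ (hP1 t.+1) (IH _ tk) i j; rewrite mxE.
    by have := mulK _ _ _ _ _ (IH _ tk) (hQ1 t.+1) i j; rewrite mxE.
(* The costs [W] depend on the range, so [M] is fixed first; the estimate is proved for all [k <= M]
   and used at [k = M]. *)
have bound (M : nat) : mge vp (N + 2 * N * M.+1 + B * M.+1) (map_mx inj (cf M X)).
  have [W [sumW hW]] := hB M.
  suff H k : (k <= M)%N ->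
      mge vp (N + 2 * N * k.+1 + \sum_(i < k.+1) W i) (map_mx inj (cf k X)).
    by apply: mgeW (H M (leqnn M)); rewrite leq_add2l.
  elim/ltn_ind: k => k IH kM; have [kkk|kkk] := leqP k kk.
    apply: (@mgeW _ _ _ N0); first by rewrite /N; lia.
    move=> i j; have [_] := hN0 (Ordinal (kkk : (k < kk.+1)%N), (i, j)).
    by rewrite !mxE.
  rewrite big_ord_recr /= addnA; apply: hW => //.
    by apply: hk0; apply: leq_ltn_trans kkk; rewrite leq_maxl.
  rewrite -map_syl eqX map_mxB; apply: mgeD => //.
    by apply: mgeW (hNY k).2; rewrite /N; nia.
  apply: mgeN => //; rewrite /conn_tail raddf_sum; apply: mge_sum => // t _.
  have tk : (k - t.+1 < k)%N by have := ltn_ord t; lia.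
  have := IH _ tk (leq_trans (ltnW tk) kM); set s := (\sum_(i < _) _)%N => hs.
  have les : (s <= \sum_(i < k) W i)%N.
    rewrite /s -(big_mkord xpredT W) -(big_mkord xpredT W).
    rewrite [X in (_ <= X)%N](@big_cat_nat _ _ _ (k - t.+1).+1)//=.
    exact: leq_addr.
  have tk1 : ((k - t.+1).+1 + t.+1 = k.+1)%N by have := ltn_ord t; lia.
  (* The coefficient of order [t.+1] of [P] or [Q] costs at most [N * t.+2], hence at most
     [2 * N * t.+1]: this is where the factor 2 comes from. *)
  have arith a : (a <= N)%N -> (a * t.+2 + (N + 2 * N * (k - t.+1).+1 + s) <=
      N + 2 * N * k.+1 + \sum_(i < k) W i)%N.
    move=> aN; have H : (a * t.+2 <= 2 * N * t.+1)%N.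
      by rewrite (mulnC 2%N) -mulnA leq_mul//; lia.
    by rewrite -tk1 mulnDr; lia.
  rewrite /= map_mxB !map_mxM; apply: mgeD => //; last apply: mgeN => //.
    by apply: mgeW (mgeM hvp (hNP t.+1).2 hs); apply: arith; rewrite /N; lia.
  by apply: mgeW (mgeM hvp hs (hNQ t.+1).2); rewrite addnC arith// /N; lia.
move=> i j; apply/LdagP; exists (N + 2 * N + B)%N => k; split.
  by have := rat k i j; rewrite mxE; apply: Kcyc_predW; lia.
have := bound k i j; rewrite !mxE; apply: vgeW; nia.
Qed.

End Overconvergent.

(** * Bases and transition matrices *)

Section Bases.
Variables (A : comNzRingType) (M : lmodType A).

Definition lc (r s : nat) (e : 'I_r -> M) (X : 'M[A]_(r, s)) (j : 'I_s) : M :=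
  \sum_(i < r) X i j *: e i.

Lemma lcM r s q (e : 'I_r -> M) (X : 'M[A]_(r, s)) (Y : 'M[A]_(s, q)) j :
  lc (lc e X) Y j = lc e (X *m Y) j.
Proof.
rewrite /lc; under eq_bigr do rewrite scaler_sumr.
rewrite exchange_big; apply: eq_bigr => i _; rewrite mxE scaler_suml.
by apply: eq_bigr => k _; rewrite scalerA mulrC.
Qed.

Lemma lc1 r (e : 'I_r -> M) j : lc e 1%:M j = e j.
Proof.
rewrite /lc (bigD1 j)//= mxE eqxx scale1r big1 ?addr0// => i ij.
by rewrite mxE (negbTE ij) scale0r.
Qed.

Lemma lc_tr r (e : 'I_r -> M) (c : 'rV[A]_r) :
  \sum_(i < r) c 0 i *: e i = lc e c^T 0.
Proof. by apply: eq_bigr => i _; rewrite mxE. Qed.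

Lemma basis_lc r s (e : 'I_r -> M) (f : 'I_s -> M) : is_basis e ->
  exists X, f = lc e X.
Proof.
move=> be; have /choice[c hc] x : exists c : 'rV[A]_r, x = \sum_(i < r) c 0 i *: e i.
  by have [c []] := be x; exists c.
exists (\matrix_(i, j) c (f j) 0 i); apply/funext => j.
by rewrite {1}(hc (f j)); apply: eq_bigr => i _; rewrite mxE.
Qed.

Lemma basis_inj r s (e : 'I_r -> M) (X Y : 'M[A]_(r, s)) : is_basis e ->
  lc e X = lc e Y -> X = Y.
Proof.
move=> be XY; apply/matrixP => i j; have [c [_ uc]] := be (lc e X j).
have H Z : lc e X j = lc e Z j -> c = \row_i Z i j.
  by move=> E; apply: uc; rewrite E; apply: eq_bigr => k _; rewrite mxE.
have := H X erefl; rewrite (H Y) ?XY// => /matrixP/(_ 0 i).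
by rewrite !mxE.
Qed.

Lemma basis_change r s (e : 'I_r -> M) (G : 'M[A]_(r, s)) H : is_basis e ->
  G *m H = 1%:M -> H *m G = 1%:M -> is_basis (lc e G).
Proof.
move=> be GH HG x; have [C xC] := basis_lc (fun _ : 'I_1 => x : M) be.
exists (H *m C)^T; split=> [|c'].
  by rewrite lc_tr trmxK lcM mulmxA GH mul1mx -xC.
rewrite /= lc_tr lcM => E; apply: trmx_inj; rewrite trmxK.
suff -> : C = G *m c'^T by rewrite mulmxA HG mul1mx.
by apply: (basis_inj be); apply/funext => j; rewrite -xC E ord1.
Qed.

(** The sizes [r] and [s] are kept distinct: a lattice comes with a basis whose length is not known
    in advance to be the rank. *)
Lemma basis_transition r s (e : 'I_r -> M) (f : 'I_s -> M) :
  is_basis e -> is_basis f ->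
  exists G H, [/\ f = lc e G, G *m H = 1%:M & H *m G = 1%:M].
Proof.
move=> be bf; have [G fG] := basis_lc f be; have [H eH] := basis_lc e bf.
exists G, H; split=> //.
  apply: (basis_inj be); apply/funext => j; rewrite -lcM -fG -eH lc1//.
by apply: (basis_inj bf); apply/funext => j; rewrite -lcM -eH -fG lc1.
Qed.

End Bases.

(** * Lattices and the tensor product condition *)

Section Lattices.
Variables (A : comNzRingType) (M : lmodType A) (L : set A).
Hypotheses (L0 : L 0) (L1 : L 1).
Hypothesis LD : forall a b, L a -> L b -> L (a + b).
Hypothesis LM : forall a b, L a -> L b -> L (a * b).

Lemma tensor_map_lc (D : set M) r (e : 'I_r -> M) (co : {x | D x} -> 'rV[A]_r) s :
  (forall x, sval x = \sum_(i < r) co x 0 i *: e i) ->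
  tensor_map s = \sum_(i < r) (\sum_(q <- s) q.2 *: co q.1) 0 i *: e i.
Proof.
move=> hco; rewrite /tensor_map; under eq_bigr do rewrite hco scaler_sumr.
rewrite exchange_big; apply: eq_bigr => i _; rewrite summxE scaler_suml.
by apply: eq_bigr => q _; rewrite mxE scalerA.
Qed.

(** An [L]-basis of [D] is an [A]-basis of [M]: surjectivity of the tensor map gives generation, and
    its injectivity gives uniqueness of coordinates. *)
Lemma lattice_basis (D : set M) :
  is_submodule L D -> is_finite_free L D -> tensor_map_iso L D ->
  exists s (e : 'I_s -> M), is_basis e /\
    forall x, D x <-> exists2 c : 'cV[A]_s, (forall i, L (c i 0)) & x = lc e c 0.
Proof.
move=> [D0 DD DZ] [s [e [De free_e]]] [surj inj]; exists s, e.
have /choice[co hco] (x : {x : M | D x}) : exists c : 'rV[A]_s,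
    ((forall i, L (c 0 i)) /\ sval x = \sum_(i < s) c 0 i *: e i) /\
    forall d : 'rV[A]_s,
      (forall i, L (d 0 i)) /\ sval x = \sum_(i < s) d 0 i *: e i -> c = d.
  by case: x => x Dx; exact: (free_e x Dx).
have coE x : sval x = \sum_(i < s) co x 0 i *: e i by have [[]] := hco x.
have coL x i : L (co x 0 i) by have [[]] := hco x.
(* The coordinates on [D], extended [A]-linearly to formal tensors; they respect every defining
   relation. *)
pose Phi (t : seq ({x : M | D x} * A)) := \sum_(q <- t) q.2 *: co q.1.
have PhiP t1 t2 : tensor_eq L t1 t2 -> Phi t1 = Phi t2.
  rewrite /Phi; elim=> {t1 t2}.
  - by [].
  - by move=> t1 t2 _ ->.
  - by move=> t1 t2 t3 _ -> _.
  - by move=> t1 t2 t1' t2' _ IH1 _ IH2; rewrite !big_cat /= IH1 IH2.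
  - by move=> t1 t2; rewrite !big_cat /= addrC.
  - by move=> x; rewrite big_seq1 big_nil scale0r.
  - by move=> x a b; rewrite !big_cons !big_nil !addr0 scalerDl.
  - move=> x y z a zxy; rewrite !big_cons !big_nil !addr0 /= -scalerDr; congr (_ *: _).
    apply: (hco z).2; split=> [i|]; first by rewrite mxE; apply: LD.
    rewrite zxy !coE -big_split /=; apply: eq_bigr => i _.
    by rewrite mxE scalerDl.
  - move=> x z l a Ll zx; rewrite !big_seq1 /= mulrC -scalerA; congr (_ *: _).
    apply: (hco z).2; split=> [i|]; first by rewrite mxE; apply: LM.
    rewrite zx coE scaler_sumr; apply: eq_bigr => i _.
    by rewrite mxE scalerA.
split=> [x|x]; last first.
  split=> [Dx|[c Lc ->]].
    have [c [[Lc xc] _]] := free_e x Dx; exists c^T; last by rewrite -lc_tr.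
    by move=> i; rewrite mxE.
  by rewrite /lc; elim/big_ind: _ => // i _; apply: DZ.
have [t xt] := surj x; exists (Phi t); split.
  by rewrite -xt; apply: tensor_map_lc.
(* The second expansion is read as the tensor with terms [c' 0 i] at [e i]. It has the same image as
   [t], hence equals [t] as a tensor, and its [Phi] is [c']. *)
move=> c' xc'; pose es i : {x : M | D x} := exist _ (e i) (De i).
have := PhiP t [seq (es i, c' 0 i) | i <- index_enum 'I_s].
have coes i : co (es i) = delta_mx 0 i.
  apply: (hco _).2; split=> [j|]; first by rewrite mxE; case: (_ && _).
  rewrite (bigD1 i)//= mxE !eqxx scale1r big1 ?addr0// => j ji.
  by rewrite mxE (negbTE ji) andbF scale0r.
rewrite /Phi big_map /= => ->.
  by under eq_bigr do rewrite coes; rewrite -row_sum_delta.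
by apply: inj; rewrite xt xc' /tensor_map big_map.
Qed.

Section Span.
Variables (r : nat) (e : 'I_r -> M).
Hypothesis be : is_basis e.

Definition Lspan : set M :=
  [set x | exists2 c : 'cV[A]_r, (forall i, L (c i 0)) & x = lc e c 0].

Lemma Lspan_submodule : is_submodule L Lspan.
Proof.
split.
- exists 0 => [i|]; first by rewrite mxE.
  by rewrite /lc big1// => i _; rewrite mxE scale0r.
- move=> _ _ [c Lc ->] [d Ld ->]; exists (c + d) => [i|]; first by rewrite mxE; apply: LD.
  by rewrite /lc -big_split; apply: eq_bigr => i _; rewrite mxE scalerDl.
- move=> a _ La [c Lc ->]; exists (a *: c) => [i|]; first by rewrite mxE; apply: LM.
  by rewrite /lc scaler_sumr; apply: eq_bigr => i _; rewrite mxE scalerA.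
Qed.

Lemma Lspan_basis i : Lspan (e i).
Proof.
exists (delta_mx i 0) => [j|]; first by rewrite mxE; case: (_ && _).
rewrite /lc (bigD1 i)//= mxE !eqxx scale1r big1 ?addr0// => j ji.
by rewrite mxE (negbTE ji) scale0r.
Qed.

Lemma Lspan_finite_free : is_finite_free L Lspan.
Proof.
exists r, e; split=> [|x [c Lc xc]]; first exact: Lspan_basis.
have [d [xd ud]] := be x; exists d; split=> [|d' [_ /ud//]]; split=> // i.
have -> : d = c^T by apply: ud; rewrite lc_tr trmxK.
by rewrite mxE.
Qed.

(** Every formal tensor reduces to a normal form [canon], with one term per basis vector, and the
    coefficients of this form are determined by the image in [M]. *)
Lemma Lspan_tensor_iso : tensor_map_iso L Lspan.
Proof.
have [S0 SD SZ] := Lspan_submodule.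
pose es i : {x : M | Lspan x} := exist _ (e i) (Lspan_basis i).
pose canon (l : seq 'I_r) (c : 'rV[A]_r) : seq ({x : M | Lspan x} * A) :=
  [seq (es i, c 0 i) | i <- l].
have canon0 l : tensor_eq L (canon l 0) [::].
  elim: l => [|i l IH]; first exact: tensor_refl.
  rewrite /canon /= mxE; apply: (tensor_cat (s1 := [:: _]) (s1' := [::])) IH.
  exact: tensor_0.
have canonD l c d : tensor_eq L (canon l (c + d)) (canon l c ++ canon l d).
  elim: l => [|i l IH]; first exact: tensor_refl.
  rewrite /canon /= mxE.
  apply: tensor_trans (tensor_cat (s1 := [:: _]) (tensor_addr L _ _ _) IH) _.
  apply: (tensor_cat (s1 := [:: _]) (s1' := [:: _])); first exact: tensor_refl.
  rewrite -!/(canon _ _) -cat1s -[(_, d 0 i) :: canon l d]cat1s !catA.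
  apply: tensor_cat; last exact: tensor_refl.
  exact: tensor_catC.
have canon1 (x : {x : M | Lspan x}) a (c : 'rV[A]_r) l : (forall i, L (c 0 i)) ->
    sval x = \sum_(i <- l) c 0 i *: e i -> tensor_eq L [:: (x, a)] (canon l (a *: c)).
  move=> Lc; elim: l x => [|i l IH] x.
    rewrite big_nil => x0; apply: tensor_trans (tensor_0 L x).
    (* Here [x = 0 *: x], so the scalar 0 moves to the other factor and the tensor vanishes. *)
    have := tensor_scale (x := x) (z := x) a L0; rewrite mul0r; apply.
    by rewrite x0 scale0r.
  rewrite big_cons => xE.
  have Dy : Lspan (c 0 i *: e i) by apply: SZ => //; exact: Lspan_basis.
  have Dz : Lspan (\sum_(j <- l) c 0 j *: e j).
    by elim/big_ind: _ => // j _; apply: SZ => //; exact: Lspan_basis.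
  apply: tensor_trans (tensor_addl (x := exist _ _ Dy) (y := exist _ _ Dz) L a xE) _.
  rewrite /canon /= mxE; apply: (tensor_cat (s1 := [:: _]) (s1' := [:: _])).
    by rewrite mulrC; apply: tensor_scale.
  exact: IH.
have /choice[co hco] (x : {x : M | Lspan x}) : exists c : 'rV[A]_r,
    (forall i, L (c 0 i)) /\ sval x = \sum_(i < r) c 0 i *: e i.
  case: x => x [c Lc xc]; exists c^T.
  by split=> [i|]; rewrite ?mxE//= lc_tr trmxK.
have coE x := (hco x).2.
pose Phi (t : seq ({x : M | Lspan x} * A)) := \sum_(q <- t) q.2 *: co q.1.
have norm t : tensor_eq L t (canon (index_enum 'I_r) (Phi t)).
  rewrite /Phi; elim: t => [|[x a] t IH].
    by rewrite big_nil; apply/tensor_sym/canon0.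
  rewrite big_cons; apply: tensor_trans (tensor_sym (canonD _ _ _)).
  apply: (tensor_cat (s1 := [:: _])) IH.
  by apply: canon1; [exact: (hco x).1|rewrite coE].
split=> [x|t1 t2 t12].
  have [c [xc _]] := be x; exists (canon (index_enum 'I_r) c).
  by rewrite /tensor_map big_map.
apply: tensor_trans (norm t1) _; apply: tensor_trans _ (tensor_sym (norm t2)).
suff -> : Phi t1 = Phi t2 by exact: tensor_refl.
have [c [_ uc]] := be (tensor_map t1).
rewrite -(uc (Phi t1) (tensor_map_lc t1 coE)) -(uc (Phi t2))//.
by rewrite t12 (tensor_map_lc t2 coE).
Qed.

End Span.
End Lattices.

(** * Connections in coordinates and a criterion for quasi-isomorphism *)

(** The two-sided inverse first forces [r = s]; then [B] is a conjugate of [A]. *)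
Lemma char_poly_similar (E : fieldType) (r s : nat) (A : 'M[E]_r) (B : 'M[E]_s)
    (G : 'M[E]_(r, s)) (H : 'M[E]_(s, r)) :
  G *m H = 1%:M -> H *m G = 1%:M -> A *m G = G *m B -> char_poly A = char_poly B.
Proof.
move=> GH HG AG; have rs : r = s.
  by apply/eqP; rewrite eqn_leq (mulmx1_min GH) (mulmx1_min HG).
case: s / rs in B G H GH HG AG *.
rewrite /char_poly.
have -> : char_poly_mx B = map_mx polyC H *m char_poly_mx A *m map_mx polyC G.
  rewrite /char_poly_mx mulmxBr mulmxBl mul_mx_scalar -scalemxAl -!map_mxM HG.
  by rewrite -mulmxA AG mulmxA HG mul1mx map_mx1 scalemx1.
by rewrite !det_mulmx mulrAC -det_mulmx -map_mxM HG map_mx1 det1 mul1r.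
Qed.

Section Connection.
Variables (F : fieldType) (M : lmodType (powser F)) (phi : M -> M).
Hypothesis hphi : is_connection phi.

Lemma phiD x y : phi (x + y) = phi x + phi y.
Proof. by have := hphi.1 1 x y; rewrite !scale1r. Qed.

Lemma phi0 : phi 0 = 0.
Proof.
by have /eqP := phiD 0 0; rewrite addr0 -subr_eq0 opprD addNKr oppr_eq0 => /eqP.
Qed.

Lemma phi_lc (r s : nat) (e : 'I_r -> M) (P : 'M[powser F]_r)
    (X : 'M[powser F]_(r, s)) j : (forall i, phi (e i) = lc e P i) ->
  phi (lc e X j) = lc e (map_mx (@theta F) X + P *m X) j.
Proof.
move=> eP; rewrite {1}/lc (big_morph phi phiD phi0).
under eq_bigr do rewrite hphi.2 eP.
rewrite big_split /= [X in _ + X](_ : _ = lc e (P *m X) j); last by rewrite -lcM.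
by rewrite /lc -big_split; apply: eq_bigr => i _; rewrite !mxE scalerDl.
Qed.

Lemma residue_cf (r : nat) (e : 'I_r -> M) (P : 'M[powser F]_r) N :
  is_basis e -> (forall i, phi (e i) = lc e P i) -> residue_matrix phi e N ->
  cf 0 P = N.
Proof.
move=> be eP /choice[y hy]; have [Y yY] := basis_lc y be.
have -> : P = map_mx (@ps_const F) N + psX F *: Y.
  apply: (basis_inj be); apply/funext => j; rewrite -eP hy yY /lc scaler_sumr.
  by rewrite -big_split; apply: eq_bigr => i _; rewrite !mxE scalerDl scalerA.
apply/matrixP => i j; rewrite !mxE /= big_ord1 /= mul0r addr0.
exact: mulr1n.
Qed.

(** Expanding [phi (f j)] in the basis [e], by the Leibniz rule or through [Q], gives
    [theta G + P G = G Q]. *)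
Lemma transition_conn (r s : nat) (e : 'I_r -> M) (f : 'I_s -> M) P Q G :
  is_basis e -> f = lc e G ->
  (forall i, phi (e i) = lc e P i) -> (forall i, phi (f i) = lc f Q i) ->
  conn P Q G = 0.
Proof.
move=> be fG eP fQ; apply/eqP; rewrite subr_eq0; apply/eqP.
by apply: (basis_inj be); apply/funext => j; rewrite -phi_lc// -lcM -fG -fQ.
Qed.

(** For a stable [D], the last two hypotheses say that [phi] is injective and surjective on [M / D],
    so the quotient complex is acyclic. *)
Lemma quasi_iso_of_sub (D : set M) : D 0 ->
  (forall x y, D x -> D y -> D (x + y)) -> (forall x, D x -> D (- x)) ->
  (forall x, D (phi x) -> D x) ->
  (forall y, exists2 d, D d & exists x, y = d + phi x) ->
  RGamma_quasi_iso phi D.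
Proof.
move=> D0 DD DN Dphi Dsurj.
have phiN x : phi (- x) = - phi x.
  by apply/eqP; rewrite -addr_eq0 -phiD addNr phi0.
have mapE y : H1_map phi [set y + phi x | x in D] = [set y + phi x | x in [set: M]].
  apply/seteqP; split=> [_ [_ [x _ <-] [x' _ <-]]|_ [x _ <-]].
    by exists (x + x') => //; rewrite phiD addrA.
  exists y; last by exists x.
  by exists 0 => //; rewrite phi0 addr0.
split; split.
- by move=> x [_ x0].
- by [].
- by move=> x [_ x0]; exists x => //; split=> //; apply: Dphi; rewrite x0.
- by move=> _ [y Dy <-]; rewrite mapE; exists y.
- move=> C1 C2; rewrite !inE => -[y1 Dy1 <-] [y2 Dy2 <-]; rewrite !mapE => E.
  (* Equal cosets in [M] give [y1 = y2 + phi x] with [x] in [M]; as [phi x] lies in [D], so does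
     [x]. *)
  have [x _ xE] : [set y2 + phi x | x in [set: M]] y1.
    by rewrite -E; exists 0 => //; rewrite phi0 addr0.
  have Dx : D x.
    apply: Dphi; have -> : phi x = y1 + - y2 by rewrite -xE addrC addKr.
    by apply: DD => //; apply: DN.
  apply/seteqP; split=> [_ [x' Dx' <-]|_ [x' Dx' <-]].
    by exists (x + x'); [exact: DD|rewrite -xE phiD addrA].
  exists (x' - x); first by apply: DD => //; apply: DN.
  by rewrite -xE phiD phiN -addrA [phi x + _]addrC subrK.
- move=> _ [y _ <-]; have [d Dd [x yE]] := Dsurj y.
  exists [set d + phi x | x in D]; first by exists d.
  rewrite mapE; apply/seteqP; split=> [_ [x' _ <-]|_ [x' _ <-]].
    by exists (x' - x) => //; rewrite yE phiD phiN -addrA [phi x + _]addrC subrK.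
  by exists (x + x') => //; rewrite yE phiD addrA.
Qed.

End Connection.

(** * Existence, cohomology and uniqueness of overconvergent lattices *)

Section OverconvergentLattices.
Variables (R : realType) (p : nat) (K : fieldType) (Kbar : closedFieldType).
Variables (iota : {rmorphism K -> Kbar}) (vp : Kbar -> \bar R).
Hypotheses (pp : prime p) (hvp : is_valuation vp) (hvpp : vp p%:R = 1%E).

Local Notation F := (Kinf p iota).
Local Notation inj := (@Kinf_val p K Kbar iota).
Local Notation L := (Ldag vp : set (powser F)).

Variables (M : lmodType (powser F)) (phi : M -> M).
Hypothesis hphi : is_connection phi.
Variables (r : nat) (lambda : 'I_r -> Kbar).
Hypothesis hlambda : has_exponents inj phi lambda.

Definition exponents : seq Kbar := [seq lambda i | i <- index_enum 'I_r].

Definition truncate (k0 m n : nat) (X : 'M[powser F]_(m, n)) : 'M[powser F]_(m, n) :=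
  mkps (fun k => if (k <= k0)%N then cf k X else 0).

Lemma Lmx_truncate k0 m n (X : 'M[powser F]_(m, n)) : Lmx vp (truncate k0 X).
Proof.
move=> i j; rewrite mxE; apply: (Ldag_poly pp hvp (k0 := k0)) => k kk0 /=.
by rewrite leqNgt kk0 /= mxE.
Qed.

Lemma Lmx_phi m n (P : 'M[powser F]_m) (X : 'M[powser F]_(m, n)) :
  Lmx vp P -> Lmx vp X -> Lmx vp (map_mx (@theta F) X + P *m X).
Proof.
move=> LP LX i j; rewrite mxE; apply: LdagD => //; last exact: LmxM.
by rewrite mxE; apply: Ldag_theta.
Qed.

(** The exponents are given in one basis only. The constant term of the horizontality of the
    transition matrix conjugates the two residue matrices. *)
Lemma phi_matrix s (e : 'I_s -> M) : is_basis e ->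
  exists2 P, (forall i, phi (e i) = lc e P i) &
    char_poly (map_mx inj (cf 0 P)) = \prod_(l <- exponents) ('X - l%:P).
Proof.
move=> be; have [P eP] := basis_lc (phi \o e) be.
have {}eP i : phi (e i) = lc e P i by rewrite -eP.
exists P => //; have [f [N [bf fN charN]]] := hlambda.
have [Q fQ] := basis_lc (phi \o f) bf.
have {}fQ i : phi (f i) = lc f Q i by rewrite -fQ.
rewrite big_map -charN -(residue_cf bf fQ fN).
have [G [H [fG GH HG]]] := basis_transition be bf.
have cGH m n (U : 'M[powser F]_(m, n)) V : U *m V = 1%:M ->
    map_mx inj (cf 0 U) *m map_mx inj (cf 0 V) = 1%:M.
  by move=> /(congr1 (@cf F 0 m m)); rewrite cfM big_ord1 cf1 /= => UV;
     rewrite -map_mxM UV map_mx1.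
apply: (char_poly_similar (cGH _ _ _ _ GH) (cGH _ _ _ _ HG)).
rewrite -!map_mxM; congr (map_mx _ _).
have /(congr1 (fun U => cf 0 U)) := transition_conn hphi be fG eP fQ.
rewrite cf_conn /syl /conn_tail big_ord0 addr0 scale0r add0r.
rewrite [cf 0 0](_ : _ = 0); last by apply/matrixP => i j; rewrite !mxE.
by move/eqP; rewrite subr_eq0 => /eqP.
Qed.

(** Puts a lattice in coordinates: stability under [phi] makes the matrix of [phi]
    overconvergent. *)
Lemma lattice_data D : is_stable_lattice L phi D ->
  exists s (e : 'I_s -> M) P, [/\ is_basis e,
    forall x, D x <-> exists2 c : 'cV[powser F]_s, Lmx vp c & x = lc e c 0,
    forall i, phi (e i) = lc e P i, Lmx vp P &
    char_poly (map_mx inj (cf 0 P)) = \prod_(l <- exponents) ('X - l%:P)].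
Proof.
case=> Dsub Dfree Diso Dphi.
have [s [e [be DE]]] := lattice_basis (Ldag0 iota pp hvp) (Ldag1 iota pp hvp)
  (LdagD pp hvp) (LdagM pp hvp) Dsub Dfree Diso.
have [P eP charP] := phi_matrix be.
exists s, e, P; split=> // [x|i j].
  split=> [/DE[c Lc ->]|[c Lc ->]]; last by apply/DE; exists c.
  by exists c => // i j; rewrite ord1; apply: Lc.
have De : D (e j).
  apply/DE; exists (col j 1%:M) => [k|].
    by rewrite !mxE; case: eqP => _; [exact: Ldag1|exact: Ldag0].
  by rewrite -[LHS]lc1; apply: eq_bigr => k _; rewrite !mxE.
have /DE[c Lc phic] := Dphi _ De.
suff -> : P i j = c i 0 by [].
have /matrixP/(_ i 0) : col j P = c; last by rewrite mxE.
apply: (basis_inj be); apply/funext => k; rewrite ord1 -phic eP.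
by apply: eq_bigr => l _; rewrite mxE.
Qed.

Lemma exists_lattice : exists D, is_stable_lattice L phi D.
Proof.
have [e [_ [be _ _]]] := hlambda.
have [P eP charP] := phi_matrix be.
have [k0 hk0] := syl_inj_large pp hvp hvpp charP charP.
pose N := truncate k0 P.
have cfN k : (k <= k0)%N -> cf k N = cf k P by move=> kk0; rewrite cf_mkps kk0.
(* The prescribed start is the identity followed by zeros: since [P] and [N] agree up to [k0], it
   solves the equation to that order. *)
have [k kk0|k kk0|G [connG G0]] := @conn_solve _ _ _ P N 0 k0
    (fun k => (k == 0%N)%:R%:M).
- rewrite cfN// [cf k 0](_ : _ = 0); last by apply/matrixP => i j; rewrite !mxE.
  rewrite /conn_tail big1 ?subr0 => [|i _].
    rewrite /syl scalar_mxC addrK.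
    by case: k {kk0} => [|k]; rewrite ?scale0r// raddf0 scaler0.
  by rewrite cfN ?scalar_mxC ?subrr//; have := ltn_ord i; lia.
- by rewrite cfN//; apply: hk0.
have [H [GH HG]] := ps_mx_inv (G0 0%N (leq0n _)).
have bf := basis_change be GH HG; set f := lc e G in bf.
have fN i : phi (f i) = lc f N i.
  rewrite /f (phi_lc hphi _ _ eP) lcM; congr (lc e _ i).
  by apply/eqP; rewrite -subr_eq0; apply/eqP.
have LN : Lmx vp N by exact: Lmx_truncate.
exists (Lspan L f); split.
- by apply: Lspan_submodule; [exact: Ldag0|exact: LdagD|exact: LdagM].
- by apply: Lspan_finite_free => //; [exact: Ldag0|exact: Ldag1].
- apply: Lspan_tensor_iso => //;
    [exact: Ldag0|exact: Ldag1|exact: LdagD|exact: LdagM].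
- move=> _ [c Lc ->]; rewrite (phi_lc hphi _ _ fN).
  exists (map_mx (@theta F) c + N *m c) => // i; apply: Lmx_phi => // a b.
  by rewrite ord1; apply: Lc.
Qed.

Lemma lattice_cohomology D :
  (forall l, l \in exponents -> (0 < padic_type p vp (- l)%R)%E) ->
  is_stable_lattice L phi D -> RGamma_quasi_iso phi D.
Proof.
move=> htype latD; have [s [e [P [be DE eP LP charP]]]] := lattice_data latD.
have [[D0 DD DZ] _ _ _] := latD.
(* The trivial connection of rank 1 has the single exponent 0, so the condition on the types of
   [mu - l] becomes one on [- l]. *)
have char0 : char_poly (map_mx inj (cf 0 (0 : 'M[powser F]_1))) =
    \prod_(mu <- [:: 0]) ('X - mu%:P).
  by rewrite big_seq1 /char_poly det_mx11 !mxE.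
have conn0 X : conn P (0 : 'M[powser F]_1) X = map_mx (@theta F) X + P *m X.
  by rewrite /conn mulmx0 subr0.
apply: quasi_iso_of_sub => //.
- by move=> x Dx; rewrite -scaleN1r; apply: DZ => //; apply/LdagN/Ldag1.
- move=> x; have [C xC] := basis_lc (fun _ : 'I_1 => x) be.
  have -> : x = lc e C 0 by rewrite -xC.
  rewrite (phi_lc hphi _ _ eP) => /DE[c Lc /esym E]; apply/DE; exists C => //.
  apply: (conn_Lmx pp hvp hvpp charP char0 _ LP).
  + by move=> l mu hl; rewrite inE => /eqP ->; rewrite sub0r; apply: htype.
  + by move=> i j; rewrite mxE; exact: Ldag0.
  + rewrite conn0 (_ : _ + _ = c)//.
    by apply: (basis_inj be); apply/funext => j; rewrite ord1.
(* Modulo [D], the terms of [y] up to [k0] can be removed. The remainder starts beyond [k0], where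
   the formal equation is solvable with zero initial coefficients. *)
- move=> y; have [Y yY] := basis_lc (fun _ : 'I_1 => y) be.
  have [k0 hk0] := syl_inj_large pp hvp hvpp charP char0.
  have [k kk0|k kk0|X [connX _]] := @conn_solve _ _ _ P (0 : 'M[powser F]_1)
      (Y - truncate k0 Y) k0 (fun=> 0); [|exact: hk0|].
    rewrite raddf0 cfD cfN cf_mkps kk0 subrr sub0r /conn_tail big1 ?oppr0// => i _.
    by rewrite mulmx0 mul0mx subrr.
  exists (lc e (truncate k0 Y) 0).
    by apply/DE; exists (truncate k0 Y) => //; exact: Lmx_truncate.
  exists (lc e X 0); rewrite (phi_lc hphi _ _ eP) -conn0 connX.
  have {1}-> : y = lc e Y 0 by rewrite -yY.
  rewrite /lc -big_split; apply: eq_bigr => i _.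
  by rewrite /= -scalerDl [X in _ + X]mxE [X in _ + (_ + X)]mxE addrC subrK.
Qed.

Lemma lattice_sub D D' :
  (forall l mu, l \in exponents -> mu \in exponents ->
    (0 < padic_type p vp (mu - l)%R)%E) ->
  is_stable_lattice L phi D -> is_stable_lattice L phi D' -> D' `<=` D.
Proof.
move=> htype /lattice_data[s [e [P [be DE eP LP charP]]]].
move=> /lattice_data[s' [f [Q [bf D'E fQ LQ charQ]]]].
have [G [_ [fG _ _]]] := basis_transition be bf.
have LG : Lmx vp G.
  apply: (conn_Lmx pp hvp hvpp charP charQ htype LP LQ).
  rewrite (transition_conn hphi be fG eP fQ) => i j; rewrite mxE.
  exact: Ldag0.
move=> x /D'E[c Lc ->]; apply/DE; exists (G *m c); first exact: LmxM.
by rewrite fG lcM.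
Qed.

End OverconvergentLattices.

Theorem theorem11p4 (R : realType) (p : nat)
  (K : fieldType) (v : K -> \bar R)
  (hK0 : [pchar K] =i pred0)
  (hv : is_valuation v) (hdisc : is_discrete v) (hcomp : is_complete v)
  (hchar : residue_char v p) (hperf : residue_perfect v p)
  (Kbar : closedFieldType) (iota : {rmorphism K -> Kbar})
  (halg : forall x : Kbar, algebraicOver iota x)
  (vp : Kbar -> \bar R) (hvp : is_valuation vp) (hvpp : vp p%:R = 1%E)
  (hext : forall x : K, v x = (v p%:R * vp (iota x))%E)
  (M : lmodType (powser (Kinf p iota))) (phi : M -> M)
  (r : nat) (hphi : is_regular_connection r phi)
  (lambda : 'I_r -> Kbar) (hlambda : has_exponents (@Kinf_val p K Kbar iota) phi lambda) :
  [/\ exists D : set M, is_stable_lattice (Ldag vp) phi D,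
      (forall i, (0 < padic_type p vp (- lambda i)%R)%E) ->
        forall D : set M, is_stable_lattice (Ldag vp) phi D ->
          RGamma_quasi_iso phi D
    & (forall i j, (0 < padic_type p vp (lambda i - lambda j)%R)%E) ->
        exists! D : set M, is_stable_lattice (Ldag vp) phi D].
Proof.
have [pp _] := hchar; have [_ hconn] := hphi.
split.
- exact: (exists_lattice pp hvp hvpp hconn hlambda).
- move=> htype D; apply: (lattice_cohomology pp hvp hvpp hconn hlambda).
  by move=> _ /mapP[i _ ->].
- move=> htype; have [D latD] := exists_lattice pp hvp hvpp hconn hlambda.
  have sub := lattice_sub pp hvp hvpp hconn hlambda.
  have {}htype l mu : l \in exponents lambda -> mu \in exponents lambda ->
      (0 < padic_type p vp (mu - l)%R)%E.
    by move=> /mapP[i _ ->] /mapP[j _ ->].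
  exists D; split=> // D' latD'.
  (* The type condition ranges over ordered pairs, so the inclusion holds in both directions. *)
  by apply/seteqP; split; apply: sub.
Qed.
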